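(* Let $G$ be a finitely generated nilpotent group of class 2 whose commutator subgroup $G'$ is cyclic. Then $G$ has a real-time combing which is boundedly asynchronous and whose length function is at most quadratic (i.e. bounded above by a polynomial of degree 2).
   Context: Let $G$ be a group with a finite inverse-closed generating set $X$. A word is an element of the free monoid $X^*$; $l(w)$ is the length of $w$, $w=_G v$ means that $w,v$ represent the same element of $G$, and the geodesic length $l_G(w)$ is the length of a shortest word in $X^*$ representing the same element as $w$. Let $\Gamma$ be the Cayley graph (vertices $g\in G$, an edge labelled $x$ from $g$ to $gx$ for each $x\in X$), and let $d_{G,X}$ be the path metric on its 1-skeleton. A word $w$ is identified with the path from $1$ labelled by $w$, parameterised by $t\in[0,\infty)$ with unit speed for $t<l(w)$ and constant, $w(t)=w(l(w))$, for $t\ge l(w)$. Words $v,w$ asynchronously $K$-fellow-travel if there is a differentiable function $h:\mathbf R\to\mathbf R$ (the relative-speed function), mapping $[0,l(v)+1]$ onto $[0,l(w)+1]$ and strictly increasing on $[0,l(v)+1]$, such that $d_{G,X}(v(t),w(h(t)))\le K$ for all $t>0$; they boundedly asynchronously fellow-travel with bound $M$ if moreover $1/M\le h'(t)\le M$ for all $t$. A language $L\subseteq X^*$ containing at least one representative of each element of $G$ is an (asynchronous) combing for $G$ over $X$ if for some $K$ all pairs $v,w\in L$ with $w=_G vx$ for some $x\in X\cup\{1\}$ asynchronously $K$-fellow-travel; it is a boundedly asynchronous combing if there is also a global $M$ such that all these pairs boundedly asynchronously fellow-travel with bound $M$. The length function of $L$ is $f:\mathbf N\to\mathbf N$, $f(n)$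 = the maximum length of a word in $L$ of geodesic length at most $n$. A real-time language is a language accepted by a deterministic real-time Turing machine: it has a fixed number of tapes, one of which is the input tape containing just the input string; at each transition it reads one input symbol and moves to the next input symbol, and on each of the other (two-way infinite) tapes it may write a symbol or blank and then stay still or move one place left or right; it halts on reaching the end of the input. A real-time combing is an asynchronous combing that is a real-time language. *)

(* Defs.v *)
From HB Require Import structures.
From mathcomp Require Import all_boot all_order all_algebra finmap.
From mathcomp Require Import all_classical all_reals all_analysis.

Set Implicit Arguments.
Unset Strict Implicit.
Unset Printing Implicit Defensive.

Import Order.TTheory GRing.Theory Num.Theory.
Import numFieldNormedType.Exports.

Local Open Scope classical_set_scope.
Local Open Scope ring_scope.

Section Groups.
Variable G : groupType.

Definition generated (A : set G) : set G :=
  smallest [set H : set G | group_closed (mem H)] A.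

Definition commutator_subgroup (A B : set G) : set G :=
  generated [set [~ x, y]%g | x in A & y in B].

(* Indexed from 0: [lower_central n] is usually written gamma_(n+1)(G). *)
Fixpoint lower_central (n : nat) : set G :=
  if n is m.+1 then commutator_subgroup (lower_central m) setT else setT.

Definition nilpotent_of_class (c : nat) : Prop :=
  lower_central c = [set 1%g] /\
  forall k, (k < c)%N -> lower_central k <> [set 1%g].

Definition cyclic_subgroup (H : set G) : Prop :=
  exists g : G, H = generated [set g].

Definition generates (X : {fset G}) : Prop := generated [set` X] = setT.

Definition inverse_closed (X : {fset G}) : Prop :=
  forall x, x \in X -> (x^-1)%g \in X.

Definition finitely_generated : Prop := exists X : {fset G}, generates X.

End Groups.

Definition word (G : groupType) (X : {fset G}) := seq X.

Section Words.
Variables (G : groupType) (X : {fset G}).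
Implicit Types (v w : word X).

Definition word_val w : G := (\prod_(x <- w) val x)%g.

Lemma geodesic_length_subproof w :
  exists n, `[< exists2 v, word_val v = word_val w & size v = n >].
Proof. by exists (size w); apply/asboolP; exists w. Qed.

Definition geodesic_length w : nat := ex_minn (geodesic_length_subproof w).

(* [f n] is the maximum of [size w] over [w] in [L] with
   [geodesic_length w <= n]; in particular this maximum exists. *)
Definition is_length_function (L : set (word X)) (f : nat -> nat) : Prop :=
  forall n,
    (exists w, [/\ L w, (geodesic_length w <= n)%N & size w = f n]) /\
    (forall w, L w -> (geodesic_length w <= n)%N -> (size w <= f n)%N).

End Words.

(* The Cayley graph as a metric graph, with one edge of length 1 from [g] to
   [g * x] for each [g] in [G] and [x] in [X].  [Interior g x s] is meant for
   [0 < s < 1]; other values of [s] are isolated junk points. *)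
Section CayleyGraph.
Variables (R : realType) (G : groupType) (X : {fset G}).

Inductive cayley_point :=
  | Vertex of G
  | Interior of G & X & R.

Definition edge_point (g : G) (x : X) (s : R) : cayley_point :=
  if s == 0 then Vertex g
  else if s == 1 then Vertex (g * val x)%g
  else Interior g x s.

(* [path_of_length p q r]: some piecewise linear path of total length [r],
   each piece of which lies in a single closed edge, joins [p] to [q]. *)
Inductive path_of_length : cayley_point -> cayley_point -> R -> Prop :=
  | path_nil p : path_of_length p p 0
  | path_cons g x s t q r :
      0 <= s <= 1 -> 0 <= t <= 1 ->
      path_of_length (edge_point g x t) q r ->
      path_of_length (edge_point g x s) q (`|s - t| + r).

Definition cayley_dist (p q : cayley_point) : R :=
  inf [set r | path_of_length p q r].

(* The value at [t < 0] is irrelevant and is set to the base point. *)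
Definition word_path (w : word X) (t : R) : cayley_point :=
  let u := Num.max 0 t in
  let i := Num.truncn u in
  if drop i w is x :: _ then edge_point (word_val (take i w)) x (u - i%:R)
  else Vertex (word_val w).

Definition relative_speed_function (K : R) (v w : word X) (h : R -> R) : Prop :=
  [/\ forall t, derivable h t 1,
      h @` `[0, (size v)%:R + 1]%classic = `[0, (size w)%:R + 1]%classic,
      {in `[0, (size v)%:R + 1] &, {homo h : s t / s < t}} &
      forall t, 0 < t ->
        cayley_dist (word_path v t) (word_path w (h t)) <= K].

Definition async_fellow_travel (K : R) (v w : word X) : Prop :=
  exists h, relative_speed_function K v w h.

Definition bounded_async_fellow_travel (K M : R) (v w : word X) : Prop :=
  exists2 h, relative_speed_function K v w h &
    forall t, 1 / M <= derive1 h t <= M.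

Definition contains_representatives (L : set (word X)) : Prop :=
  forall g : G, exists2 w, L w & word_val w = g.

Definition combing_pair (L : set (word X)) (v w : word X) : Prop :=
  [/\ L v, L w &
      word_val w = word_val v \/
      exists x : X, word_val w = (word_val v * val x)%g].

Definition async_combing (L : set (word X)) : Prop :=
  contains_representatives L /\
  exists K : R, forall v w, combing_pair L v w -> async_fellow_travel K v w.

Definition bounded_async_combing (L : set (word X)) : Prop :=
  contains_representatives L /\
  exists K M : R, 0 < M /\
    forall v w, combing_pair L v w -> bounded_async_fellow_travel K M v w.

Definition at_most_quadratic_length (L : set (word X)) : Prop :=
  exists2 f : nat -> nat, is_length_function L f &
    exists2 p : {poly R}, size p = 3%N & forall n, (f n)%:R <= p.[n%:R].

End CayleyGraph.

Inductive head_move := MoveLeft | Stay | MoveRight.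

Definition shift_head (m : head_move) (i : int) : int :=
  match m with MoveLeft => i - 1 | Stay => i | MoveRight => i + 1 end.

(* [rt_tapes] counts the work tapes, i.e. all tapes except the input tape.
   A work tape cell holds a symbol or, as [None], a blank.  Leaving a cell
   unchanged is the same as writing back the symbol just read. *)
Record rt_machine (A : finType) := RTMachine {
  rt_tapes : nat;
  rt_state : finType;
  rt_symbol : finType;
  rt_start : rt_state;
  rt_accepting : {set rt_state};
  rt_step : rt_state -> A -> {ffun 'I_rt_tapes -> option rt_symbol} ->
    rt_state * {ffun 'I_rt_tapes -> option rt_symbol * head_move}
}.

Section RealTime.
Variables (A : finType) (T : rt_machine A).

Record rt_config := RTConfig {
  cfg_state : rt_state T;
  cfg_tape : 'I_(rt_tapes T) -> int -> option (rt_symbol T);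
  cfg_head : 'I_(rt_tapes T) -> int
}.

Definition rt_initial : rt_config :=
  RTConfig (rt_start T) (fun _ _ => None) (fun _ => 0).

Definition rt_next (c : rt_config) (a : A) : rt_config :=
  let: (q, act) :=
    rt_step (cfg_state c) a [ffun k => cfg_tape c k (cfg_head c k)] in
  RTConfig q
    (fun k i => if i == cfg_head c k then (act k).1 else cfg_tape c k i)
    (fun k => shift_head (act k).2 (cfg_head c k)).

(* The machine halts exactly when the whole input has been read. *)
Definition rt_accepts (w : seq A) : bool :=
  cfg_state (foldl rt_next rt_initial w) \in rt_accepting T.

End RealTime.

Definition real_time_language (A : finType) (L : set (seq A)) : Prop :=
  exists T : rt_machine A, forall w, L w <-> rt_accepts T w.

Definition real_time_combing (R : realType) (G : groupType) (X : {fset G})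
    (L : set (word X)) : Prop :=
  async_combing R L /\ real_time_language L.

(* Main.v *)
Require Import Defs.
From HB Require Import structures.
From mathcomp Require Import all_boot all_order all_algebra finmap.
From mathcomp Require Import all_classical all_reals all_analysis.
From mathcomp Require Import zify ring lra.

(* Up to finite index, G has coordinates u, v, c such that the u-parts commute, the
   v-parts commute, the c-part is central and the first two commute up to a central
   element omega (u, v) bilinear in u and v.  The combing line of an element runs
   through its u-part and then through its (v, c)-part, both as straight lines and
   both in time l.  Right multiplication by a generator changes u by a bounded
   amount d, and (v, c) by a bounded amount after the shear c |-> c - omega (d, v).
   In the second phase one path therefore differs from the other by d and by a
   shear, which is linear and respects straight lines: the paths fellow travel
   when they are run at proportional speeds.
   Straight lines are recognized in real time because a coordinate moves exactly
   once every p steps, p depending on the coordinate: the count s %/ p is always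
   within 1 of s / (l + 1) times its final value l %/ p, and a machine checks a
   period by sweeping a marked zone back and forth.  Counters check that l is
   comparable to 1 + max (|c|, u_i ^ 2, v_j ^ 2).  This makes l at most quadratic
   in the geodesic length and makes the lengths for neighbouring elements
   comparable; conversely every a with a ^ 2 <= l is of the form l %/ p. *)

Set Implicit Arguments.
Unset Strict Implicit.
Unset Printing Implicit Defensive.

Import Order.TTheory GRing.Theory Num.Theory.
Import numFieldNormedType.Exports.
Local Open Scope ring_scope.

(** * Real-time machines *)

(** The coordinates come from a dichotomy on a generator [z] of the commutator subgroup. If [z] has
    infinite order, commutators define a single alternating form with integer values on G modulo
    [z]. Pairs with nonzero commutator are split off as for a symplectic basis; since integers
    cannot be divided, this gives coordinates only up to finite index. If [z] has order k, all k-th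
    powers are central, and an abelian subgroup of finite index with neither u-part nor c-part is
    enough. The squares in the condition on l are dictated by the shear: n generators change u and v
    by O(n), but each of them may change c by a multiple of |v|, so c can reach the order of n ^ 2.
    An element has in general several words, with different l and different periods: the language is
    cut out by inequalities that a machine can test, and no normal form is selected. Fellow
    travelling is therefore proved for arbitrary words of neighbouring elements, from straightness
    and comparable lengths. *)

Definition rt_run (A : finType) (T : rt_machine A) (w : seq A) :=
  foldl (@rt_next A T) (rt_initial T) w.

Lemma rt_run_rcons (A : finType) (T : rt_machine A) w a :
  rt_run T (rcons w a) = rt_next (rt_run T w) a.
Proof. by rewrite /rt_run foldl_rcons. Qed.

Definition rt_read (A : finType) (T : rt_machine A) (c : rt_config T) :=
  [ffun k => cfg_tape c k (cfg_head c k)].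

Lemma rt_nextE (A : finType) (T : rt_machine A) (c : rt_config T) a :
  let: r := rt_step (cfg_state c) a (rt_read c) in
  [/\ cfg_state (rt_next c a) = r.1,
      forall k i, cfg_tape (rt_next c a) k i =
        if i == cfg_head c k then (r.2 k).1 else cfg_tape c k i &
      forall k, cfg_head (rt_next c a) k = shift_head (r.2 k).2 (cfg_head c k)].
Proof. by rewrite /rt_next -/(rt_read c); case: rt_step. Qed.

(** * Boolean combinations and finite-state preprocessing of real-time machines *)

Section Product.
Variables (A : finType) (op : bool -> bool -> bool) (T1 T2 : rt_machine A).
Notation k1 := (rt_tapes T1).
Notation k2 := (rt_tapes T2).
Notation S1 := (rt_symbol T1).
Notation S2 := (rt_symbol T2).

(** All tapes of a machine share one symbol type, hence the sum [S1 + S2]. Tapes of [T1] only ever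
    carry [inl] symbols and those of [T2] only [inr], so decoding loses nothing in a run. *)
Definition prod_machine : rt_machine A :=
  @RTMachine A (k1 + k2) (rt_state T1 * rt_state T2)%type (S1 + S2)%type
    (rt_start T1, rt_start T2)
    [set q | op (q.1 \in rt_accepting T1) (q.2 \in rt_accepting T2)]
    (fun q a t =>
       let r1 := rt_step q.1 a
         [ffun i => obind (fun s => if s is inl x then Some x else None)
                      (t (lshift k2 i))] in
       let r2 := rt_step q.2 a
         [ffun i => obind (fun s => if s is inr x then Some x else None)
                      (t (rshift k1 i))] in
       ((r1.1, r2.1),
        [ffun k : 'I_(k1 + k2) => match fintype.split k with
                   | inl i => (omap inl (r1.2 i).1, (r1.2 i).2)
                   | inr i => (omap inr (r2.2 i).1, (r2.2 i).2)
                   end])).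

Lemma prod_machine_run w :
  let c := rt_run prod_machine w in
  let c1 := rt_run T1 w in let c2 := rt_run T2 w in
  [/\ cfg_state c = (cfg_state c1, cfg_state c2),
      forall i z, cfg_tape c (lshift k2 i) z = omap inl (cfg_tape c1 i z),
      forall i z, cfg_tape c (rshift k1 i) z = omap inr (cfg_tape c2 i z),
      forall i, cfg_head c (lshift k2 i) = cfg_head c1 i &
      forall i, cfg_head c (rshift k1 i) = cfg_head c2 i].
Proof.
elim/last_ind: w => [|w a [E1 E2 E3 E4 E5]] //=.
rewrite !rt_run_rcons.
move: (rt_nextE (rt_run prod_machine w) a).
move: (rt_next (rt_run prod_machine w) a) => c' [N1 N2 N3].
have [N11 N12 N13] := rt_nextE (rt_run T1 w) a.
have [N21 N22 N23] := rt_nextE (rt_run T2 w) a.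
have R1 : [ffun i => obind (fun s => if s is inl x then Some x else None)
            (rt_read (rt_run prod_machine w) (lshift k2 i))] =
          rt_read (rt_run T1 w).
  by apply/ffunP => i; rewrite !ffunE E4 E2; case: cfg_tape.
have R2 : [ffun i => obind (fun s => if s is inr x then Some x else None)
            (rt_read (rt_run prod_machine w) (rshift k1 i))] =
          rt_read (rt_run T2 w).
  by apply/ffunP => i; rewrite !ffunE E5 E3; case: cfg_tape.
have splitl i : fintype.split (lshift k2 i : 'I_(k1 + k2)) = inl i.
  exact: (unsplitK (inl i)).
have splitr i : fintype.split (rshift k1 i : 'I_(k1 + k2)) = inr i.
  exact: (unsplitK (inr i)).
rewrite E1 /= R1 R2 in N1 N2 N3.
split => [|i z|i z|i|i].
- by rewrite N1 N11 N21.
- by rewrite N2 N12 ffunE splitl E4 E2 /=; case: eqP.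
- by rewrite N2 N22 ffunE splitr E5 E3 /=; case: eqP.
- by rewrite N3 N13 ffunE splitl E4.
- by rewrite N3 N23 ffunE splitr E5.
Qed.

Lemma prod_machine_accepts w :
  rt_accepts prod_machine w = op (rt_accepts T1 w) (rt_accepts T2 w).
Proof.
have [E _ _ _ _] := prod_machine_run w.
by rewrite /rt_accepts -/(rt_run prod_machine w) E inE.
Qed.

End Product.

Section Transducer.
Variables (A B S : finType) (s0 : S) (step : S -> A -> S * option B).
Variables (F : pred S) (T : rt_machine B).

Definition trans_run (w : seq A) : S * seq B :=
  foldl (fun so a => let r := step so.1 a in
           (r.1, if r.2 is Some b then rcons so.2 b else so.2)) (s0, [::]) w.

Lemma trans_run_rcons w a :
  trans_run (rcons w a) =
  (let r := step (trans_run w).1 a in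
   (r.1, if r.2 is Some b then rcons (trans_run w).2 b else (trans_run w).2)).
Proof. by rewrite /trans_run foldl_rcons. Qed.

(** At most one output letter per input letter is what keeps the composite real-time. When nothing
    is emitted, [T] idles by rewriting the cells it scans. *)
Definition trans_machine : rt_machine A :=
  @RTMachine A (rt_tapes T) (rt_state T * S)%type (rt_symbol T)
    (rt_start T, s0) [set q | (q.1 \in rt_accepting T) && F q.2]
    (fun q a t =>
       let r := step q.2 a in
       if r.2 is Some b then
         let u := rt_step q.1 b t in ((u.1, r.1), u.2)
       else ((q.1, r.1), [ffun k => (t k, Stay)])).

Lemma trans_machine_run w :
  let c := rt_run trans_machine w in
  let c' := rt_run T (trans_run w).2 in
  [/\ cfg_state c = (cfg_state c', (trans_run w).1),
      forall i z, cfg_tape c i z = cfg_tape c' i z &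
      forall i, cfg_head c i = cfg_head c' i].
Proof.
elim/last_ind: w => [|w a [E1 E2 E3]] //=.
rewrite rt_run_rcons trans_run_rcons.
move: (rt_nextE (rt_run trans_machine w) a).
move: (rt_next (rt_run trans_machine w) a) => c' [N1 N2 N3].
have R : rt_read (rt_run trans_machine w) =
         rt_read (rt_run T (trans_run w).2).
  by apply/ffunP => i; rewrite !ffunE E2 E3.
rewrite E1 R /= in N1 N2 N3.
rewrite /=; case E: (step (trans_run w).1 a).2 N1 N2 N3 => [b|] /= N1 N2 N3.
  rewrite rt_run_rcons.
  have [N11 N12 N13] := rt_nextE (rt_run T (trans_run w).2) b.
  split => [|i z|i]; first by rewrite N1 N11.
    by rewrite N2 N12 E2 E3.
  by rewrite N3 N13 E3.
split => [|i z|i]; first by rewrite N1.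
  by rewrite N2 !ffunE E2 E3; case: eqP => // ->.
by rewrite N3 ffunE E3.
Qed.

Lemma trans_machine_accepts w :
  rt_accepts trans_machine w =
  rt_accepts T (trans_run w).2 && F (trans_run w).1.
Proof.
have [E _ _] := trans_machine_run w.
by rewrite /rt_accepts -/(rt_run trans_machine w) E inE.
Qed.

End Transducer.

Definition full_machine (A : finType) : rt_machine A :=
  @RTMachine A 0 unit void tt [set _ | true] (fun q _ _ => (q, [ffun _ => (None, Stay)])).

Lemma full_machine_accepts (A : finType) w : rt_accepts (full_machine A) w.
Proof. by rewrite /rt_accepts inE. Qed.

(** * One-tape machines that check a period or the sign of a sum *)

Section OneTape.
Variables (A Q S : finType) (q0 : Q) (F : pred Q).
Variable step : Q -> A -> option S -> Q * option S * head_move.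

Definition one_tape : rt_machine A :=
  @RTMachine A 1 Q S q0 [set q | F q]
    (fun q a t => let r := step q a (t ord0) in
       (r.1.1, [ffun _ => (r.1.2, r.2)])).

Definition tape1_run (w : seq A) : Q * (int -> option S) * int :=
  foldl (fun c a =>
    let: (q, t, h) := c in
    let r := step q a (t h) in
    (r.1.1, (fun i => if i == h then r.1.2 else t i), shift_head r.2 h))
    (q0, (fun=> None), 0) w.

Lemma tape1_run_rcons w a :
  tape1_run (rcons w a) =
  (let: (q, t, h) := tape1_run w in
    let r := step q a (t h) in
    (r.1.1, (fun i => if i == h then r.1.2 else t i), shift_head r.2 h)).
Proof. by rewrite /tape1_run foldl_rcons. Qed.

Lemma one_tape_accepts w : rt_accepts one_tape w = F (tape1_run w).1.1.
Proof.
rewrite /rt_accepts -/(rt_run one_tape w).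
suff [-> _ _] : [/\ cfg_state (rt_run one_tape w) = (tape1_run w).1.1,
  forall z, cfg_tape (rt_run one_tape w) ord0 z = (tape1_run w).1.2 z &
  cfg_head (rt_run one_tape w) ord0 = (tape1_run w).2] by rewrite inE.
elim/last_ind: w => [|w a [E1 E2 E3]] //=.
rewrite rt_run_rcons tape1_run_rcons.
move: (rt_nextE (rt_run one_tape w) a).
move: (rt_next (rt_run one_tape w) a) => c' [N1 N2 N3].
case: (tape1_run w) E1 E2 E3 => [[q t] h] /= E1 E2 E3.
rewrite /= ffunE E1 E3 E2 in N1 N2 N3.
split => [|z|]; first by rewrite N1.
  by rewrite N2 ffunE /= E3 E2.
by rewrite N3 ffunE E3.
Qed.

End OneTape.

(** The shift to [k.+1] puts each move at the end of its period, so that exactly [s %/ p] moves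
    occur among the first [s] letters. *)
Definition move_at (p : nat) (b : bool) (k : nat) : option bool :=
  if (p %| k.+1)%N then Some b else None.

Definition periodic (m : seq (option bool)) : Prop :=
  exists p b, (0 < p)%N /\
    forall k, (k < size m)%N -> nth None m k = move_at p b k.

(** State [None] is failure; [Some None] measures the first period by marking one cell per letter;
    [Some (Some (d, b))] sweeps, leftwards iff [d], expecting moves of sign [b]. The letter read on
    the blank beyond the zone completes the period, so [p - 1] marks measure [p]. *)
Definition period_step (q : option (option (bool * bool))) (a : option bool)
    (c : option unit) : option (option (bool * bool)) * option unit * head_move :=
  match q with
  | None => (None, c, Stay)
  | Some None =>
      if a is Some b then (Some (Some (true, b)), c, MoveLeft)
      else (Some None, Some tt, MoveRight)
  | Some (Some (d, b)) =>
      let d' := if c is None then ~~ d else d in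
      if a == (if c is None then Some b else None)
      then (Some (Some (d', b)), c, if d' then MoveLeft else MoveRight)
      else (None, c, Stay)
  end.

Definition period_machine : rt_machine (option bool) :=
  one_tape (Some None) (fun q => q != None) period_step.

Definition marked (n : nat) (z : int) : option unit :=
  if (0 <= z) && (z < n%:Z) then Some tt else None.

Lemma periodic_rcons m a : periodic (rcons m a) -> periodic m.
Proof.
case=> p [b [p0 H]]; exists p, b; split=> // k km.
rewrite -H ?size_rcons ?nth_rcons ?km //; lia.
Qed.

(* After the first period [p] the tape is marked exactly on [0, p - 1), and the
   head sweeps it back and forth: a move is due exactly when the head has left
   the marked zone. *)
Definition period_inv m (c : option (option (bool * bool)) * (int -> option unit) * int) :=
  let: (q, t, h) := c in
  match q with
  | None => ~ periodic m
  | Some None => [/\ forall k, nth None m k = None,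
      t =1 marked (size m) & h = (size m)%:Z]
  | Some (Some (d, b)) => exists p u v,
     [/\ [/\ (v < p)%N, (0 < u)%N & size m = (u * p + v)%N],
         forall k, (k < size m)%N -> nth None m k = move_at p b k,
         t =1 marked p.-1, d = odd u &
         h = if odd u then p%:Z - 2 - v%:Z else v%:Z]
  end.

Lemma period_run_inv m : period_inv m (tape1_run (Some None) period_step m).
Proof.
elim/last_ind: m => [|m a].
  split=> //= [k|z]; first by rewrite nth_nil.
  by rewrite /marked; case: ifP => // /andP[]; lia.
rewrite tape1_run_rcons.
case: (tape1_run _ _ m) => [[[[[d b]|]|] t] h] /=; last first.
- by move=> nP P; apply: nP; apply: periodic_rcons P.
- case=> mN tE hE; case: a => [b|] /=.
  + exists (size m).+1, 1%N, 0%N; rewrite size_rcons; split => //=.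
    * by split=> //; rewrite mul1n addn0.
    * move=> k km; rewrite nth_rcons /move_at; case: ltngtP => kE; rewrite ?mN.
      - by rewrite gtnNdvd //; lia.
      - lia.
      - by rewrite kE dvdnn.
    * by move=> z; rewrite tE; case: eqP => // ->; rewrite hE.
    * rewrite hE; lia.
  + rewrite size_rcons; split=> /=.
    * by move=> k; rewrite nth_rcons mN; case: ifP => // _; case: ifP.
    * move=> z; rewrite tE hE /marked; case: eqP => zE.
        by rewrite ifT //; apply/andP; lia.
      by congr (if _ then _ else _); lia.
    * rewrite hE; lia.
- case=> p [u] [v] [[vp u0 sm] mE tE dE hE].
  have cE : t h = if v.+1 == p then None else Some tt.
    rewrite tE hE /marked; case: (odd u); case: eqP => E;
    by [rewrite ifF //; lia|rewrite ifT //; lia].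
  have dvdE : (p %| (size m).+1)%N = (v.+1 == p).
    rewrite sm -addnS dvdn_addr ?dvdn_mull //; case: eqP => [<-|ne]; first exact: dvdnn.
    by rewrite gtnNdvd //; lia.
  have -> : (if t h is None then Some b else None) = move_at p b (size m).
    by rewrite /move_at dvdE cE; case: eqP.
  case: eqP => [->|ne] /=.
  + exists p, (if v.+1 == p then u.+1 else u), (if v.+1 == p then 0%N else v.+1).
    rewrite size_rcons cE; split=> /=.
    * by case: eqP => E; split; lia.
    * move=> k km; rewrite nth_rcons.
      by case: (ltngtP k (size m)) => [kE|kE|-> //]; [exact: mE|lia].
    * move=> z; case: eqP => [->|_]; last exact: tE.
      by rewrite -tE cE.
    * by rewrite dE; case: eqP.
    * rewrite hE dE; case: eqP => E /=; case: (odd u) => /=; lia.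
  + case=> p' [b' [p'0 H]]; apply: ne.
    have pm : (p.-1 < size m)%N by have := leq_pmull p u0; lia.
    have nthm k : (k < size m)%N -> move_at p b k = move_at p' b' k.
      by move=> km; rewrite -mE // -H ?size_rcons ?nth_rcons ?km //; lia.
    (* Both patterns agree on [m], which already contains the first move of each; hence each of the
       two periods divides the other. *)
    have [pp bb] : p = p' /\ b = b'.
      have := nthm _ pm; rewrite /move_at prednK; last lia.
      rewrite dvdnn; case: ifP => // dvd1 [bb'].
      split=> //; apply/eqP; rewrite eqn_dvd dvd1 andbT.
      have /nthm : (p'.-1 < size m)%N by have := dvdn_leq _ dvd1; lia.
      by rewrite /move_at prednK // dvdnn; case: ifP.
    have := H (size m); rewrite size_rcons nth_rcons ltnn eqxx -pp -bb => -> //.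
Qed.

Lemma period_machine_accepts m : periodic m <-> rt_accepts period_machine m.
Proof.
rewrite one_tape_accepts; have := period_run_inv m.
case: tape1_run => [[[[[d b]|]|] t] h] /=.
- case=> p [u] [v] [[vp u0 sm] mE _ _ _]; split=> // _.
  by exists p, b; split=> //; lia.
- case=> mN _ _; split=> // _.
  exists (size m).+1, true; split=> // k km.
  by rewrite mN /move_at gtnNdvd //; lia.
- by move=> nP; split.
Qed.

Definition move_val (a : option bool) : int :=
  match a with None => 0 | Some true => 1 | Some false => -1 end.

(* [None] is an end marker.  The state records whether the origin has been
   marked yet and the sign of the last nonzero position of the head. *)
Definition counter_step (q : bool + option bool) (a : option (option bool))
    (c : option unit) : (bool + option bool) * option unit * head_move :=
  match q with
  | inl b => (inl false, c, Stay)
  | inr s =>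
      let at0 := (s == None) || (c != None) in
      let c' := if at0 then Some tt else c in
      if a is Some d then
        (inr (Some (if at0 then 0 <= move_val d else s == Some true)), c',
         match d with
         | None => Stay | Some true => MoveRight | Some false => MoveLeft end)
      else (inl (at0 || (s == Some true)), c, Stay)
  end.

Definition counter_machine : rt_machine (option (option bool)) :=
  one_tape (inr None) (fun q => q == inl true) counter_step.

(** The head position is the running sum, and its sign changes only through the marked origin, so a
    finite state can follow it. Arrival at 0 from -1 is noticed only at the next reading of the
    tape: this is what the end marker is for. *)
Lemma counter_machine_accepts ds :
  rt_accepts counter_machine (rcons (map Some ds) None) =
  (0 <= \sum_(d <- ds) move_val d).
Proof.
rewrite one_tape_accepts tape1_run_rcons.
have : let: (q, t, h) := tape1_run (inr None) counter_step (map Some ds) in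
  [/\ h = \sum_(d <- ds) move_val d & if q is inr s then
  if s is Some b then (forall z, (t z != None) = (z == 0)) /\
      (h != 0 -> b = (0 <= h))
  else h = 0 /\ forall z, t z = None else False].
  elim/last_ind: ds => [|ds d]; first by rewrite big_nil.
  rewrite map_rcons tape1_run_rcons big_rcons /= -(addrC (move_val d)).
  case: (tape1_run _ _ _) => [[[b|s] t] h] /= [hE] //.
  have -> : shift_head match d with None => Stay | Some true => MoveRight
                      | Some false => MoveLeft end h = h + move_val d.
    by case: d => [[]|] /=; lia.
  rewrite -hE; case: s => [b|] [H1 H2] /=; (split; first by rewrite addrC).
    have tE : (t h != None) = (h == 0) by exact: H1.
    rewrite tE; case: eqP => [h0|/eqP hn0].
      split=> [z|]; last by rewrite h0 add0r.
      by case: (eqVneq z h) => [->|_]; [rewrite h0|exact: H1].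
    split=> [z|hd]; first by case: (eqVneq z h) => [->|_]; [rewrite tE|exact: H1].
    have -> : (Some b == Some true) = b by case: (b).
    rewrite H2 //; move: hd hn0; case: d => [[]|] /= hd hn0.
    - by apply/idP/idP; lia.
    - by apply/idP/idP; lia.
    - by rewrite addr0.
  split=> [z|]; last by rewrite H1 add0r.
  by rewrite H1 eq_sym; case: (eqVneq 0 z) => //= _; rewrite H2.
case: (tape1_run _ _ _) => [[[b|s] t] h] /= [hE] //; rewrite -hE.
case: s => [b|] [H1 H2] /=; last by rewrite H1.
have -> : (inl ((t h != None) || (Some b == Some true)) == inl true :> bool + option bool)
  = (t h != None) || b by case: (t h) => [[]|] //; case: (b).
by rewrite H1; case: eqVneq => [->|/H2 ->].
Qed.

(** Recognition under a promise: outside [D] the machine may answer anything. Well-formedness is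
    thus tested once, in [real_time_rt_on], and every other test may rely on it. *)
Definition rt_on (A : finType) (D P : seq A -> Prop) : Prop :=
  exists T : rt_machine A, forall w, D w -> (P w <-> rt_accepts T w).

Section RtOn.
Variable A : finType.
Implicit Types D P : seq A -> Prop.

Lemma rt_on_ext D P P' :
  (forall w, D w -> (P w <-> P' w)) -> rt_on D P -> rt_on D P'.
Proof. by move=> PP' [T HT]; exists T => w Dw; rewrite -PP' // HT. Qed.

Lemma rt_on_and D P P' : rt_on D P -> rt_on D P' -> rt_on D (fun w => P w /\ P' w).
Proof.
move=> [T HT] [T' HT']; exists (prod_machine andb T T') => w Dw.
by rewrite prod_machine_accepts HT // HT' //; split => [[-> ->]|/andP].
Qed.

Lemma rt_on_or D P P' : rt_on D P -> rt_on D P' -> rt_on D (fun w => P w \/ P' w).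
Proof.
move=> [T HT] [T' HT']; exists (prod_machine orb T T') => w Dw.
by rewrite prod_machine_accepts HT // HT' //; split => /orP.
Qed.

Lemma rt_on_trans (B S : finType) (s0 : S) (st : S -> A -> S * option B)
    (F : pred S) D (D' P : seq B -> Prop) :
  (forall w, D w -> F (trans_run s0 st w).1 -> D' (trans_run s0 st w).2) -> rt_on D' P ->
  rt_on D (fun w => P (trans_run s0 st w).2 /\ F (trans_run s0 st w).1).
Proof.
move=> DD' [T HT]; exists (trans_machine s0 st F T) => w Dw.
rewrite trans_machine_accepts; split.
  by move=> [Pw Fw]; rewrite Fw andbT; apply/HT => //; apply: DD'.
by move=> /andP[Tw Fw]; split=> //; apply/HT => //; apply: DD'.
Qed.

Lemma rt_on_dfa (S : finType) (s0 : S) (st : S -> A -> S) (F : pred S) D :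
  rt_on D (fun w => F (foldl st s0 w)).
Proof.
pose st' s a := (st s a, None : option void).
have run w : (trans_run s0 st' w).1 = foldl st s0 w.
  elim/last_ind: w => // w a IH.
  by rewrite trans_run_rcons foldl_rcons -IH.
exists (trans_machine s0 st' F (full_machine void)) => w _.
by rewrite trans_machine_accepts full_machine_accepts run.
Qed.

Lemma rt_on_all_pred (p : pred A) D : rt_on D (fun w => all p w).
Proof.
apply: rt_on_ext (rt_on_dfa true (fun b a => b && p a) id D) => w _.
suff -> : foldl (fun b a => b && p a) true w = all p w by [].
by elim/last_ind: w => // w a IH; rewrite foldl_rcons all_rcons IH andbC.
Qed.

Lemma rt_on_forall (I : Type) (r : seq I) D (P : I -> seq A -> Prop) :
  (forall i, rt_on D (P i)) ->
  rt_on D (fun w => foldr (fun i Q => P i w /\ Q) True r).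
Proof.
move=> HP; elim: r => [|i r IH] /=; last exact: rt_on_and.
by exists (full_machine A) => w _; rewrite full_machine_accepts.
Qed.

Lemma rt_on_fin_forall (I : finType) D (P : I -> seq A -> Prop) :
  (forall i, rt_on D (P i)) -> rt_on D (fun w => forall i, P i w).
Proof.
move=> /(rt_on_forall (enum I)); apply: rt_on_ext => w _.
have -> : (forall i, P i w) = (forall i, i \in enum I -> P i w).
  by apply/propext; split=> [H i _|H i]; [exact: H|apply: H; rewrite mem_enum].
elim: (enum I) => [|i r IH] //=; rewrite IH; split.
  by move=> [Pi Pr] j; rewrite inE => /orP[/eqP->|/Pr].
by move=> H; split=> [|j jr]; apply: H; rewrite inE ?eqxx ?jr ?orbT.
Qed.

Lemma rt_on_fin_exists (I : finType) D (P : I -> seq A -> Prop) :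
  (forall i, rt_on D (P i)) -> rt_on D (fun w => exists i, P i w).
Proof.
move=> HP.
have /(rt_on_fin_forall (P := fun i w => ~ P i w)) [T HT] i : rt_on D (fun w => ~ P i w).
  have [T HT] := HP i; exists (prod_machine (fun b _ => ~~ b) T T) => w Dw.
  by rewrite prod_machine_accepts HT //; split => /negP.
exists (prod_machine (fun b _ => ~~ b) T T) => w Dw.
rewrite prod_machine_accepts; split.
  by move=> [i Pi]; apply/negP => /(HT w Dw)/(_ i).
move=> nT; apply: contrapT => nP; move/negP: nT; apply.
by apply/HT => // i Pi; apply: nP; exists i.
Qed.

Lemma rt_on_pmap (B : finType) (f : A -> option B) D (D' P : seq B -> Prop) :
  (forall w, D w -> D' (pmap f w)) -> rt_on D' P ->
  rt_on D (fun w => P (pmap f w)).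
Proof.
move=> DD' HP; pose st (s : unit) a := (tt, f a).
have run w : trans_run tt st w = (tt, pmap f w).
  elim/last_ind: w => // w a IH.
  rewrite trans_run_rcons IH /= -cats1 pmap_cat /=; case: (f a) => //= [b|].
    by rewrite cats1.
  by rewrite cats0.
have H := rt_on_trans (F := xpredT) (s0 := tt) (st := st) (D := D) _ HP.
apply: rt_on_ext (H _) => [w Dw|w Dw _]; last by rewrite run; apply: DD'.
by rewrite run; split=> [[]|].
Qed.

End RtOn.

Lemma real_time_rt_on (A : finType) (D P : seq A -> Prop) :
  real_time_language (D : set (seq A)) -> rt_on D P ->
  real_time_language ((fun w => D w /\ P w) : set (seq A)).
Proof.
move=> [T1 H1] [T2 H2]; exists (prod_machine andb T1 T2) => w.
rewrite prod_machine_accepts; split.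
  by move=> [/[dup] Dw /H1-> /(H2 w Dw)->].
by move=> /andP[/H1 Dw /(H2 w Dw)].
Qed.

(** Blocks of fixed length are decoded by a buffer of at most [k] letters. A full block that is not
    a code word is never flushed: the next letter overflows the buffer into failure, and at the end
    of the input a nonempty buffer is rejected. *)
Lemma real_time_code (A E : finType) (k : nat) (code : E -> seq A)
    (LE : set (seq E)) :
  (0 < k)%N -> (forall e, size (code e) = k) -> injective code ->
  real_time_language LE ->
  real_time_language [set w | exists2 W, LE W & w = flatten (map code W)]%classic.
Proof.
move=> k0 szc injc [T HT].
pose nl : k.-bseq A := [bseq].
pose st (s : option (k.-bseq A)) x :=
  if s is Some b then
    if [pick e | code e == rcons b x] is Some e then (Some nl, Some e)
    else (insub (rcons b x), None)
  else (None, None).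
have runD w u : trans_run (Some nl) st (w ++ u) =
    foldl (fun so a => let r := st so.1 a in
      (r.1, if r.2 is Some b then rcons so.2 b else so.2)) (trans_run (Some nl) st w) u.
  by rewrite /trans_run foldl_cat.
have run W : trans_run (Some nl) st (flatten (map code W)) = (Some nl, W).
  elim/last_ind: W => // W e IH.
  rewrite map_rcons -cats1 flatten_cat /= cats0.
  have pre u v : u ++ v = code e -> v <> [::] ->
      exists2 b : k.-bseq A, trans_run (Some nl) st (flatten (map code W) ++ u) = (Some b, W) &
         b = u :> seq A.
    elim/last_ind: u v => [|u x IHu] v uv vn.
      by rewrite cats0 IH; exists nl.
    have [b brun bu] : exists2 b : k.-bseq A,
        trans_run (Some nl) st (flatten (map code W) ++ u) = (Some b, W) &
        b = u :> seq A by apply: (IHu (x :: v)) => //; rewrite -cat_rcons.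
    rewrite -rcons_cat trans_run_rcons brun /= bu.
    have sz : (size (rcons u x) < k)%N.
      rewrite -(szc e) -uv size_cat; case: v vn {uv} => //= *; lia.
    case: pickP => [e' /eqP e'E|_] /=.
      by move: sz; rewrite -e'E szc ltnn.
    exists (Bseq (ltnW sz)) => //=; congr (_, _).
    by case: insubP => [b' _ /= b'E|]; [congr Some; apply: val_inj|rewrite ltnW].
  case/lastP cE: (code e) => [|u x].
    by have := szc e; rewrite cE => kE; move: (k0); rewrite -[X in (_ < X)%N]kE.
  have [b brun bu] : exists2 b : k.-bseq A,
        trans_run (Some nl) st (flatten (map code W) ++ u) = (Some b, W) &
        b = u :> seq A by apply: (pre _ [:: x]) => //; rewrite cats1.
  rewrite -rcons_cat trans_run_rcons brun /= bu.
  case: pickP => [e' /eqP|/(_ e)]; last by rewrite cE eqxx.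
  by rewrite -cE => /injc ->.
have inv w : if (trans_run (Some nl) st w).1 is Some b then
    w = flatten (map code (trans_run (Some nl) st w).2) ++ b else True.
  elim/last_ind: w => // w x; rewrite trans_run_rcons /=.
  case: (trans_run _ _ w) => [[b|] W] //= wE.
  case: pickP => [e /eqP eE|_] /=.
    by rewrite map_rcons -(cats1 (map code W)) flatten_cat /= !cats0 eE wE rcons_cat.
  by case: insubP => [b' _ /= ->|//]; rewrite wE rcons_cat.
exists (trans_machine (Some nl) st (pred1 (Some nl)) T) => w.
rewrite trans_machine_accepts; split.
  by move=> [W /HT LW ->]; rewrite run LW /=.
move=> /andP[/HT LW /eqP bE]; have := inv w; rewrite bE => ->.
by exists (trans_run (Some nl) st w).2; rewrite ?cats0.
Qed.

(** In a periodic sequence the first move has index [p - 1], so [find] reveals the period. Once a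
    move has occurred, [few_moves] means [l %/ p <= p], hence [(l %/ p) ^ 2 <= l], and [many_moves]
    means [p <= 2 * (l %/ p) + 2], which bounds [l] by a multiple of [(l %/ p).+1 ^ 2]. *)
Definition few_moves (m : seq (option bool)) : bool :=
  (count isSome m <= (find isSome m).+1)%N.

Definition many_moves (m : seq (option bool)) : bool :=
  (find isSome m <= (2 * count isSome m).+1)%N.

Definition ended (w : seq (option (option bool))) : Prop :=
  exists m, w = rcons (map Some m) None.

Lemma pmap_ended m : pmap id (rcons (map (@Some (option bool)) m) None) = m.
Proof. by rewrite -cats1 pmap_cat cats0; elim: m => //= a m ->. Qed.

Lemma rt_on_nonneg :
  rt_on ended (fun w => 0 <= \sum_(d <- pmap id w) move_val d).
Proof.
exists counter_machine => _ [m ->].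
by rewrite counter_machine_accepts pmap_ended.
Qed.

Lemma find_rcons (T : Type) (p : pred T) s x :
  find p (rcons s x) =
  if has p s then find p s else if p x then size s else (size s).+1.
Proof.
rewrite -cats1 find_cat /=; case: ifP => // _.
by case: ifP => _; rewrite ?addn0 ?addn1.
Qed.

(** Reduces a numerical test to the counter machine: it suffices to write the quantity as a sum of
    weights -1, 0, 1 that a finite automaton emits. *)
Lemma rt_on_weights (S : finType) (s0 : S) (wt : S -> option bool -> S * option bool)
    (P : seq (option bool) -> Prop) (v : seq (option bool) -> int) :
  let run := foldl (fun so a => let r := wt so.1 a in (r.1, so.2 + move_val r.2)) (s0, 0) in
  (forall m, (run m).2 = v m) -> (forall m, P m <-> 0 <= v m) ->
  rt_on ended (fun w => P (pmap id w)).
Proof.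
move=> run runE PE.
pose st s (a : option (option bool)) :=
  if a is Some d then let r := wt s d in (r.1, Some (Some r.2)) else (s, Some None).
have stE m : exists ds, trans_run s0 st (map Some m) = ((run m).1, map Some ds) /\
    \sum_(d <- ds) move_val d = (run m).2.
  elim/last_ind: m => [|m a [ds [dsE sE]]]; first by exists [::]; rewrite big_nil.
  exists (rcons ds (wt (run m).1 a).2).
  rewrite map_rcons trans_run_rcons dsE /= big_rcons /= /run foldl_rcons /=.
  by rewrite map_rcons -/run -sE addrC.
have stE' m : exists ds, trans_run s0 st (rcons (map Some m) None) =
    ((run m).1, rcons (map Some ds) None) /\ \sum_(d <- ds) move_val d = (run m).2.
  have [ds [dsE sE]] := stE m; exists ds.
  by rewrite trans_run_rcons dsE.
have H := rt_on_trans (F := xpredT) (s0 := s0) (st := st) (D := ended) _ rt_on_nonneg.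
apply: rt_on_ext (H _) => [_ [m ->]|_ [m ->] _]; have [ds [-> sE]] := stE' m; last first.
  by exists ds.
rewrite /= !pmap_ended sE runE PE; by split=> [[]|].
Qed.

Lemma rt_on_few_moves : rt_on ended (fun w => few_moves (pmap id w)).
Proof.
pose wt (s : bool) (a : option bool) :=
  match s, a with
  | false, None => (false, Some true)
  | false, Some _ => (true, None)
  | true, None => (true, None)
  | true, Some _ => (true, Some false)
  end.
(* Leading blanks weigh 1 and later moves -1, while the first move is free; the summand [has]
   corrects for that free move. *)
apply: (@rt_on_weights _ false wt few_moves
  (fun m => (find isSome m)%:Z + has isSome m - (count isSome m)%:Z)); last first.
  move=> m; rewrite /few_moves; have := has_count isSome m.
  by case: (has _ m) => /= H; split; lia.
move=> m; set run := foldl _ _.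
suff -> : run m = (has isSome m, (find isSome m)%:Z + has isSome m - (count isSome m)%:Z) by [].
elim/last_ind: m => // m a IH.
rewrite /run foldl_rcons -/run IH /= has_rcons find_rcons -cats1 count_cat /=.
case: a => [b|] /=; case: ifP => hm /=; congr (_, _); try lia.
  by rewrite hasNfind ?hm //; lia.
by rewrite hasNfind ?hm //; lia.
Qed.

Lemma rt_on_many_moves : rt_on ended (fun w => many_moves (pmap id w)).
Proof.
pose wt (s : bool * bool) (a : option bool) :=
  match s.1, a with
  | false, None => ((false, ~~ s.2), if s.2 then Some false else None)
  | _, Some _ => ((true, s.2), Some true)
  | true, None => (s, None)
  end.
(* [find <= 2 * count + 1] is the same as [find./2 <= count], so only every second leading blank is
   charged; the second state bit is the parity of the blanks. *)
apply: (@rt_on_weights _ (false, false) wt many_moves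
  (fun m => (count isSome m)%:Z - ((find isSome m)./2)%:Z)); last first.
  by move=> m; rewrite /many_moves; split; lia.
move=> m; set run := foldl _ _.
suff -> : run m = ((has isSome m, odd (find isSome m)),
   (count isSome m)%:Z - ((find isSome m)./2)%:Z) by [].
elim/last_ind: m => // m a IH.
rewrite /run foldl_rcons -/run IH /= has_rcons find_rcons -cats1 count_cat /=.
case: a => [b|] /=; case: ifP => hm /=.
- by congr (_, _); lia.
- by rewrite hasNfind ?hm //=; congr (_, _); lia.
- by congr (_, _); lia.
- rewrite hasNfind ?hm //=; congr (_, _).
  by case: (boolP (odd (size m))) => /=; lia.
Qed.

(** * Words made of two phases and a closing letter *)

Section TwoPhases.
Variables A1 A2 T : finType.
Let E : finType := (A1 + A2 + T)%type.

(** The closing letter has two functions: it carries the coset representative, and it is the end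
    marker awaited by the counters. *)
Definition two_phase (s1 : seq A1) (s2 : seq A2) (t : T) : seq E :=
  rcons (map (inl \o inl) s1 ++ map (inl \o inr) s2) (inr t).

Definition is_two_phase (W : seq E) : Prop := exists s1 s2 t, W = two_phase s1 s2 t.

Definition phase1 (W : seq E) : seq A1 :=
  pmap (fun e => if e is inl (inl a) then Some a else None) W.

Definition phase2 (W : seq E) : seq A2 :=
  pmap (fun e => if e is inl (inr a) then Some a else None) W.

Lemma pmap_two_phase (B : Type) (f : E -> option B) s1 s2 t :
  pmap f (two_phase s1 s2 t) =
  pmap (f \o inl \o inl) s1 ++ pmap (f \o inl \o inr) s2 ++ pmap f [:: inr t].
Proof.
rewrite /two_phase -cats1 !pmap_cat -catA; congr (_ ++ (_ ++ _)).
  by elim: s1 => //= a s1 <-.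
by elim: s2 => //= a s2 <-.
Qed.

Lemma pmap_None (B C : Type) (s : seq B) : pmap (fun=> None : option C) s = [::].
Proof. by elim: s. Qed.

Lemma pmap_Some (B C : Type) (f : B -> C) s : pmap (fun x => Some (f x)) s = map f s.
Proof. by elim: s => //= a s ->. Qed.

Lemma phase1_two_phase s1 s2 t : phase1 (two_phase s1 s2 t) = s1.
Proof.
by rewrite /phase1 pmap_two_phase (pmap_None _ s2) /= cats0 (pmap_Some id) map_id.
Qed.

Lemma phase2_two_phase s1 s2 t : phase2 (two_phase s1 s2 t) = s2.
Proof.
by rewrite /phase2 pmap_two_phase (pmap_None _ s1) /= cats0 (pmap_Some id) map_id.
Qed.

Lemma real_time_two_phase : real_time_language (is_two_phase : set (seq E)).
Proof.
pose st (s : option (option bool)) (e : E) : option (option bool) :=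
  match s, e with
  | Some (Some false), inl (inl _) => Some (Some false)
  | Some (Some _), inl (inr _) => Some (Some true)
  | Some (Some _), inr _ => Some None
  | _, _ => None
  end.
have inv W : match foldl st (Some (Some false)) W return Prop with
  | Some (Some false) => exists s1, W = map (inl \o inl) s1
  | Some (Some true) => exists s1 s2, W = map (inl \o inl) s1 ++ map (inl \o inr) s2
  | Some None => is_two_phase W
  | None => True end.
  elim/last_ind: W => [|W e]; first by exists [::].
  rewrite foldl_rcons; case: (foldl _ _ W) => [[[|]|]|] //=.
  - move=> [s1 [s2 WE]]; case: e => [[a|a]|t] //=.
      by exists s1, (rcons s2 a); rewrite map_rcons -rcons_cat WE.
    by exists s1, s2, t; rewrite WE.
  - move=> [s1 WE]; case: e => [[a|a]|t] /=.
    + by exists (rcons s1 a); rewrite map_rcons WE.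
    + by exists s1, [:: a]; rewrite cats1 WE.
    + by exists s1, [::], t; rewrite /two_phase cats0 WE.
have [M HM] := rt_on_dfa (Some (Some false)) st (pred1 (Some None)) (fun=> True).
exists M => W; rewrite -HM //; split; last first.
  by move=> /eqP WE; have := inv W; rewrite WE.
move=> [s1 [s2 [t ->]]]; rewrite /two_phase foldl_rcons foldl_cat.
have -> : foldl st (Some (Some false)) (map (inl \o inl) s1) = Some (Some false).
  by elim: s1.
suff [b ->] : exists b, foldl st (Some (Some false)) (map (inl \o inr) s2) = Some (Some b).
  by case: b.
elim/last_ind: s2 => [|s2 a [b IH]]; first by exists false.
by exists true; rewrite map_rcons foldl_rcons IH; case: b {IH}.
Qed.

Lemma rt_on_phase1 (P : seq A1 -> Prop) :
  rt_on (fun=> True) P -> rt_on is_two_phase (fun W => P (phase1 W)).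
Proof. exact: rt_on_pmap. Qed.

Lemma rt_on_phase2 (P : seq A2 -> Prop) :
  rt_on (fun=> True) P -> rt_on is_two_phase (fun W => P (phase2 W)).
Proof. exact: rt_on_pmap. Qed.

Lemma rt_on_ended1 (g : A1 -> option bool) (P : seq (option bool) -> Prop) :
  rt_on ended (fun w => P (pmap id w)) ->
  rt_on is_two_phase (fun W => P (map g (phase1 W))).
Proof.
pose f (e : E) := match e with inl (inl a) => Some (Some (g a))
                             | inl (inr a) => None | inr _ => Some None end.
have fE s1 s2 t : pmap f (two_phase s1 s2 t) = rcons (map Some (map g s1)) None.
  by rewrite pmap_two_phase (pmap_None _ s2) (pmap_Some (Some \o g)) cats1 map_comp.
move=> /(rt_on_pmap (f := f) (D := is_two_phase)) H.
apply: rt_on_ext (H _) => W [s1 [s2 [t ->]]].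
  by rewrite fE pmap_ended phase1_two_phase.
by rewrite fE; exists (map g s1).
Qed.

Lemma rt_on_ended2 (g : A2 -> option bool) (P : seq (option bool) -> Prop) :
  rt_on ended (fun w => P (pmap id w)) ->
  rt_on is_two_phase (fun W => P (map g (phase2 W))).
Proof.
pose f (e : E) := match e with inl (inr a) => Some (Some (g a))
                             | inl (inl a) => None | inr _ => Some None end.
have fE s1 s2 t : pmap f (two_phase s1 s2 t) = rcons (map Some (map g s2)) None.
  by rewrite pmap_two_phase (pmap_None _ s1) (pmap_Some (Some \o g)) cats1 map_comp.
move=> /(rt_on_pmap (f := f) (D := is_two_phase)) H.
apply: rt_on_ext (H _) => W [s1 [s2 [t ->]]].
  by rewrite fE pmap_ended phase2_two_phase.
by rewrite fE; exists (map g s2).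
Qed.

Lemma rt_on_size_eq :
  rt_on is_two_phase (fun W => size (phase1 W) = size (phase2 W)).
Proof.
(* A counter only tests a sign, so equality of the two lengths is tested as two inequalities. *)
have H (b : bool) : rt_on is_two_phase (fun W =>
    0 <= (-1) ^+ b * ((size (phase1 W))%:Z - (size (phase2 W))%:Z)).
  pose f (e : E) := match e with inl (inl a) => Some (Some (Some (~~ b)))
                               | inl (inr a) => Some (Some (Some b)) | inr _ => Some None end.
  have fE s1 s2 t : pmap f (two_phase s1 s2 t) =
      rcons (map Some (nseq (size s1) (Some (~~ b)) ++ nseq (size s2) (Some b))) None.
    rewrite pmap_two_phase (pmap_Some (fun=> Some (Some b)) s2)
      (pmap_Some (fun=> Some (Some (~~ b))) s1) catA cats1 map_cat !map_nseq.
    by congr (rcons (_ ++ _) _); [elim: s1|elim: s2] => //= _ s ->.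
  have H := rt_on_pmap (f := f) (D := is_two_phase) _ rt_on_nonneg.
  apply: rt_on_ext (H _) => W [s1 [s2 [t ->]]]; rewrite fE.
    rewrite pmap_ended phase1_two_phase phase2_two_phase big_cat /=.
    have sumE n a : \sum_(d <- nseq n a) move_val d = move_val a *+ n.
      by rewrite big_nseq -Monoid.iteropE.
    rewrite !sumE; case: b {f fE H} => /=; split; lia.
  by exists (nseq (size s1) (Some (~~ b)) ++ nseq (size s2) (Some b)).
apply: rt_on_ext (rt_on_and (H false) (H true)) => W _.
by rewrite expr0 expr1; split; lia.
Qed.

End TwoPhases.

(** * Periodic motion *)

Definition periodic_moves (p : nat) (b : bool) (l : nat) : seq (option bool) :=
  mkseq (move_at p b) l.

Lemma periodic_movesP m :
  periodic m -> exists2 p, (0 < p)%N & exists b, m = periodic_moves p b (size m).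
Proof.
move=> [p [b [p0 H]]]; exists p => //; exists b.
apply: (@eq_from_nth _ None) => [|k km]; first by rewrite size_mkseq.
by rewrite nth_mkseq // H.
Qed.

Lemma periodic_movesW p b l : (0 < p)%N -> periodic (periodic_moves p b l).
Proof.
by move=> p0; exists p, b; split=> // k; rewrite size_mkseq => kl; rewrite nth_mkseq.
Qed.

Lemma periodic_movesS p b l :
  periodic_moves p b l.+1 = rcons (periodic_moves p b l) (move_at p b l).
Proof. by rewrite /periodic_moves /mkseq -addn1 iotaD map_cat cats1. Qed.

Lemma divSn p l : (0 < p)%N -> (l.+1 %/ p = l %/ p + (p %| l.+1))%N.
Proof. by move=> p0; rewrite divnS // addnC. Qed.

Lemma count_periodic p b l : (0 < p)%N ->
  count isSome (periodic_moves p b l) = (l %/ p)%N.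
Proof.
move=> p0; elim: l => [|l IH]; first by rewrite div0n.
rewrite periodic_movesS -cats1 count_cat IH /= addn0 divSn //.
by rewrite /move_at; case: ifP.
Qed.

Lemma find_periodic p b l : (0 < p)%N ->
  find isSome (periodic_moves p b l) = if (p <= l)%N then p.-1 else l.
Proof.
move=> p0; elim: l => [|l IH]; first by case: ifP => //; lia.
rewrite periodic_movesS find_rcons has_count count_periodic // divn_gt0 // IH.
rewrite size_mkseq /move_at; case: (leqP p l) => pl.
  by rewrite ifT //; lia.
case: (eqVneq p l.+1) => [->|ne]; first by rewrite dvdnn leqnn.
by rewrite gtnNdvd //= ?ifF //; lia.
Qed.

Lemma few_periodic p b l : (0 < p)%N ->
  few_moves (periodic_moves p b l) = (l %/ p <= p)%N.
Proof.
move=> p0; rewrite /few_moves count_periodic // find_periodic //.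
by case: (leqP p l) => pl; [rewrite prednK|rewrite divn_small // ?leq0n].
Qed.

Lemma many_periodic p b l : (0 < p)%N ->
  many_moves (periodic_moves p b l) =
  if (p <= l)%N then (p <= (2 * (l %/ p)).+2)%N else (l <= 1)%N.
Proof.
move=> p0; rewrite /many_moves count_periodic // find_periodic //.
by case: (leqP p l) => pl; [rewrite -ltnS prednK|rewrite divn_small].
Qed.

Lemma all_moves_periodic p b l : (0 < p)%N ->
  all isSome (periodic_moves p b l) = (p == 1)%N || (l == 0)%N.
Proof.
move=> p0; rewrite all_count count_periodic // size_mkseq.
case: (eqVneq p 1%N) => [->|p1]; first by rewrite divn1 eqxx.
case: l => [|l]; first by rewrite div0n.
by apply/negbTE; rewrite neq_ltn ltn_Pdiv //; lia.
Qed.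

Lemma no_moves_periodic p b l : (0 < p)%N ->
  all (pred1 None) (periodic_moves p b l) = (l < p)%N.
Proof.
move=> p0; rewrite -[LHS]negbK -has_predC.
have -> : has (predC (pred1 None)) (periodic_moves p b l) = has isSome (periodic_moves p b l).
  by apply: eq_has => -[].
by rewrite has_count count_periodic // divn_gt0 // -ltnNge.
Qed.

(* The length is either [c] or the first multiple of [c] past the square of the
   largest [a k]; since it is at least every [a k ^ 2], the number [a k] is a
   quotient [l %/ p]. *)
Lemma exists_length (K : finType) (a : K -> nat) (c : nat) :
  exists l (p : K -> nat) r,
    [/\ forall k, [/\ (0 < p k)%N, (l %/ p k = a k)%N & (a k <= p k)%N],
        (0 < r)%N, (l %/ r = c)%N &
        (exists2 k, (p k <= l)%N & (p k <= (2 * a k).+2)%N) \/ (r = 1%N \/ l = 0%N)].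
Proof.
have quot l x : (x ^ 2 <= l)%N ->
    exists2 p, [/\ (0 < p)%N, (l %/ p = x)%N & (x <= p)%N] &
      (0 < x)%N -> p = (l %/ x)%N.
  case: x => [|x] xl; first by exists l.+1 => //; split=> //; rewrite divn_small.
  have xp : (x.+1 <= l %/ x.+1)%N by rewrite leq_divRL // -expnS.
  exists (l %/ x.+1)%N => //; split => //; first lia.
  have := divn_eq l x.+1; have := ltn_pmod l (ltn0Sn x).
  move: (l %/ x.+1)%N (l %% x.+1)%N xp => y r xy rx ->.
  by rewrite mulnC divnMDl ?divn_small ?addn0 //; lia.
pose D := (\max_k a k)%N.
have aD k : (a k <= D)%N by exact: (leq_bigmax_cond _ _).
have build l : (D ^ 2 <= l)%N -> exists p : K -> nat, forall k,
    [/\ [/\ (0 < p k)%N, (l %/ p k = a k)%N & (a k <= p k)%N] &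
      (0 < a k)%N -> p k = (l %/ a k)%N].
  move=> Dl; have H k : exists p, [/\ (0 < p)%N, (l %/ p = a k)%N & (a k <= p)%N] /\
      ((0 < a k)%N -> p = (l %/ a k)%N).
    have [|p P1 P2] := quot l (a k); last by exists p.
    by apply: leq_trans Dl; rewrite leq_exp2r.
  by have [p pP] := fin_all_exists H; exists p => k; have [] := pP k.
have [cD|Dc] := leqP (D ^ 2) c.
  have [p pP] := build _ cD; exists c, p, 1%N; split=> //.
  - by move=> k; have [] := pP k.
  - by rewrite divn1.
  - by right; left.
have D0 : (0 < D)%N by case: (D) Dc.
(* Since [c < D ^ 2], the first multiple of [c] past [D ^ 2] overshoots by at most [c] and stays
   below [2 * D ^ 2]. If [c = 0], the third coordinate gets a period longer than [l]. *)
have [l [r [lD1 lD2 r0 lr]]] : exists l r,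
    [/\ (D ^ 2 <= l)%N, (l < 2 * D ^ 2)%N, (0 < r)%N & (l %/ r = c)%N].
  case: (posnP c) => [->|c0].
    exists (D ^ 2)%N, (D ^ 2).+1; split => //; last by rewrite divn_small.
    by rewrite mul2n -addnn -addn1 leq_add2l expn_gt0 D0.
  pose r := (D ^ 2 %/ c).+1; exists (c * r)%N, r; split => //.
  - by rewrite mulnC ltnW // ltn_ceil.
  - rewrite mulnS; have := leq_divM (D ^ 2) c; rewrite mulnC; lia.
  - by rewrite mulnK.
have [p pP] := build _ lD1; exists l, p, r; split=> //.
  by move=> k; have [] := pP k.
left.
(* The coordinate that attains the maximum is the fast one: its period [l %/ D] is less than
   [2 * D]. *)
have [k kD] : exists k, a k = D.
  apply: contrapT => nk.
  suff : (\max_k a k <= D.-1)%N by rewrite -/D; lia.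
  apply/bigmax_leqP => k _.
  have := aD k; rewrite leq_eqVlt => /orP[/eqP kE|]; last lia.
  by case: nk; exists k.
exists k; have [[p0 pl ap] /(_ _)] := pP k; rewrite kD => /(_ D0) pE.
  by rewrite pE leq_div.
rewrite pE; suff : (l %/ D < 2 * D)%N by lia.
by rewrite ltn_divLR // -mulnA mulnn.
Qed.

(** * The language of a polarization *)

Definition pairing (n m : nat) (w : 'I_n -> 'I_m -> int)
    (u : {ffun 'I_n -> int}) (v : {ffun 'I_m -> int}) : int :=
  \sum_i \sum_j u i * v j * w i j.

(* Coordinates on a subgroup of finite index: two abelian subgroups, whose
   elements commute up to the central elements [zz c].  When [zok] is false the
   third coordinate is absent, i.e. only [c = 0] is allowed. *)
Record polarization (G : groupType) := Polarization {
  pn : nat; pm : nat;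
  xx : {ffun 'I_pn -> int} -> G;
  yy : {ffun 'I_pm -> int} -> G;
  zz : int -> G;
  pw : 'I_pn -> 'I_pm -> int;
  zok : bool;
  reps : seq G;
  xxD : forall u u', xx (u + u') = (xx u * xx u')%g;
  yyD : forall v v', yy (v + v') = (yy v * yy v')%g;
  zzD : forall c c', zz (c + c') = (zz c * zz c')%g;
  zzC : forall c g, commute (zz c) g;
  xxyy : forall u v, (xx u * yy v = yy v * xx u * zz (pairing pw u v))%g;
  pw0 : ~~ zok -> forall i j, pw i j = 0;
  coords_inj : forall u v c, zok || (c == 0) ->
    (xx u * yy v * zz c = 1)%g -> [/\ u = 0, v = 0 & c = 0];
  coords_gen : forall g, exists u v c t,
    [/\ zok || (c == 0), t \in reps & g = (xx u * yy v * zz c * t)%g]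
}.

Section Combing.
Variables (G : groupType) (P : polarization G).

Notation n := (pn P).
Notation m := (pm P).
Notation U := {ffun 'I_n -> int}.
Notation V := {ffun 'I_m -> int}.
Notation xx := (@xx G P).
Notation yy := (@yy G P).
Notation zz := (@zz G P).
Notation zok := (zok P).
Notation omega := (pairing (pw (p:=P))).
Implicit Types (u : U) (v : V) (c : int).

Definition point u v c : G := (xx u * yy v * zz c)%g.

Lemma hom0 (W : zmodType) (f : W -> G) :
  (forall a b, f (a + b) = (f a * f b)%g) -> f 0 = 1%g.
Proof. by move=> fD; apply: (@mulgI _ (f 0)); rewrite -fD addr0 mulg1. Qed.

Lemma homN (W : zmodType) (f : W -> G) :
  (forall a b, f (a + b) = (f a * f b)%g) -> forall a, f (- a) = (f a)^-1%g.
Proof.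
by move=> fD a; apply: (@mulgI _ (f a)); rewrite -fD subrr (hom0 fD) mulgV.
Qed.

Lemma pairingDl u u' v : omega (u + u') v = omega u v + omega u' v.
Proof.
rewrite /pairing -big_split; apply: eq_bigr => i _; rewrite -big_split.
by apply: eq_bigr => j _ /=; rewrite ffunE !mulrDl.
Qed.

Lemma pairingDr u v v' : omega u (v + v') = omega u v + omega u v'.
Proof.
rewrite /pairing -big_split; apply: eq_bigr => i _; rewrite -big_split.
by apply: eq_bigr => j _ /=; rewrite ffunE mulrDr !mulrDl.
Qed.

Lemma pairing0r u : omega u 0 = 0.
Proof. by apply: (addrI (omega u 0)); rewrite -pairingDr !addr0. Qed.

Lemma pairingNr u v : omega u (- v) = - omega u v.
Proof. by apply: (addrI (omega u v)); rewrite -pairingDr !subrr pairing0r. Qed.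

(** Bringing [xx (u' - u)] to the left of [yy (- v)] costs the central factor with exponent
    [omega (u' - u) v]. This is the source of the shear. *)
Lemma point_div u v c u' v' c' :
  ((point u v c)^-1 * point u' v' c' =
   point (u' - u) (v' - v) (c' - c + omega (u' - u) v))%g.
Proof.
have swap a b : (yy b * xx a = xx a * yy b * zz (- omega a b))%g.
  by rewrite xxyy -mulgA -zzD subrr (hom0 (@zzD _ P)) mulg1.
rewrite /point !invgM -(homN (@xxD _ P)) -(homN (@yyD _ P)) -(homN (@zzD _ P)).
rewrite -!mulgA [(zz (- c) * _)%g]zzC -!mulgA.
rewrite [(xx (- u) * (xx u' * _))%g]mulgA -xxD [- u + u']addrC mulgA swap.
rewrite -!mulgA; congr (_ * _)%g.
rewrite [v' - v]addrC yyD -!mulgA; congr (_ * _)%g.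
rewrite [LHS]zzC -!mulgA; congr (_ * _)%g.
by rewrite -!zzD pairingNr opprK addrA.
Qed.

Lemma point_inj u v c u' v' c' : zok || (c == 0) -> zok || (c' == 0) ->
  point u v c = point u' v' c' -> [/\ u = u', v = v' & c = c'].
Proof.
move=> cok c'ok E.
have w0 : ~~ zok -> omega (u' - u) v = 0.
  by move=> /pw0 W; rewrite /pairing big1 // => i _; rewrite big1 // => j _; rewrite W mulr0.
have := point_div u v c u' v' c'; rewrite E mulVg => /esym/coords_inj[].
  case: (boolP zok) cok c'ok w0 => //= nz /eqP -> /eqP -> /(_ isT) ->.
  by [].
move=> /eqP; rewrite subr_eq0 => /eqP -> /eqP; rewrite subr_eq0 => /eqP ->.
rewrite subrr; have -> : omega 0 v = 0.
  by apply: (addrI (omega 0 v)); rewrite -pairingDl !addr0.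
by move=> H; split=> //; lia.
Qed.

Notation M := (option bool).
Notation A1 := {ffun 'I_n -> M}.
Notation A2 := ({ffun 'I_m -> M} * M)%type.
Notation T := (seq_sub (reps P)).
(** One letter moves all coordinates of its phase at once, each by -1, 0 or 1, so that a single
    duration serves them all. *)
Definition step_letter : finType := (A1 + A2 + T)%type.

Definition letter_val (e : step_letter) : G :=
  match e with
  | inl (inl f) => xx [ffun i => move_val (f i)]
  | inl (inr f) => (yy [ffun j => move_val (f.1 j)] * zz (move_val f.2))%g
  | inr t => val t
  end.

Variable g0 : G.

Definition letters_half : seq G := [:: 1%g, g0 & map letter_val (enum step_letter)].

Definition letters : {fset G} :=
  seq_fset tt (letters_half ++ [seq g^-1%g | g <- letters_half]).

Lemma lettersP g : (g \in letters) =
  (g \in letters_half) || (g \in [seq h^-1%g | h <- letters_half]).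
Proof. by rewrite seq_fsetE mem_cat. Qed.

Lemma letters_inv : inverse_closed letters.
Proof.
move=> g; rewrite !lettersP => /orP[gs|/seq.mapP[h hs ->]]; apply/orP.
  by right; apply/seq.mapP; exists g.
by left; rewrite invgK.
Qed.

Lemma mem_letters1 : 1%g \in letters.
Proof. by rewrite lettersP inE eqxx. Qed.

Lemma mem_letters0 : g0 \in letters.
Proof. by rewrite lettersP !inE eqxx orbT. Qed.

Lemma mem_letter_val e : letter_val e \in letters.
Proof. by rewrite lettersP /letters_half !in_cons map_f ?orbT // mem_enum. Qed.

Lemma mem_letters_rep t : t \in reps P -> t \in letters.
Proof. by move=> tr; exact: (mem_letter_val (inr (SeqSub tr))). Qed.

Definition to_letter (g : G) : letters := insubd [` mem_letters1]%fset g.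

Lemma to_letterK g : g \in letters -> val (to_letter g) = g.
Proof. by move=> gX; rewrite val_insubd gX. Qed.

(* The trivial detours [g0, g0^-1] and [1, 1] make the code injective, whatever
   coincidences there are between values of letters. *)
Definition code (e : step_letter) : word letters :=
  to_letter (letter_val e) ::
  [seq to_letter (if e' == e then g0 else 1%g) | e' <- enum step_letter] ++
  [seq to_letter (if e' == e then g0^-1%g else 1%g) | e' <- enum step_letter].

Definition code_len : nat := (1 + 2 * #|step_letter|)%N.

Lemma size_code e : size (code e) = code_len.
Proof. by rewrite /code -cat1s !size_cat !size_map /code_len cardE mul2n addnn enumT. Qed.

Lemma code_inj : g0 != 1%g -> injective code.
Proof.
move=> g0_neq1 e e' [_ /eqP]; rewrite eqseq_cat ?size_map // => /andP[/eqP + _].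
move=> /eq_in_map/(_ e); rewrite mem_enum => /(_ isT).
rewrite eqxx => /(congr1 val); rewrite to_letterK ?mem_letters0 //.
case: eqP => // _; rewrite to_letterK ?mem_letters1 // => g01.
by rewrite g01 eqxx in g0_neq1.
Qed.

Lemma word_val_cat (w1 w2 : word letters) :
  word_val (w1 ++ w2) = (word_val w1 * word_val w2)%g.
Proof. by rewrite /word_val big_cat. Qed.

Lemma word_val_code e : word_val (code e) = letter_val e.
Proof.
rewrite /word_val big_cons big_cat /= to_letterK ?mem_letter_val //.
pose flag (h : G) := [seq to_letter (if e' == e then h else 1%g) | e' <- enum step_letter].
suff -> : (\prod_(i <- flag g0) val i * \prod_(i <- flag g0^-1%g) val i = 1)%g.
  by rewrite mulg1.
have prodE (h : G) : h \in letters ->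
    (\prod_(i <- flag h) val i = h)%g.
  move=> hX; rewrite big_map.
  have : e \in enum step_letter by rewrite mem_enum.
  have : uniq (enum step_letter) by rewrite enum_uniq.
  elim: (enum step_letter) => // a s IH /= /andP[aNs us]; rewrite inE big_cons.
  case: eqP => [ae _|ne /= es].
    rewrite -ae eqxx to_letterK // big1_seq ?mulg1 // => e' /andP[_ e's].
    by rewrite ifN ?to_letterK ?mem_letters1 //; apply: contraNneq aNs => e'e; rewrite -ae -e'e.
  by rewrite ifN ?(eq_sym a) ?to_letterK ?mem_letters1 ?mul1g ?IH //; apply/eqP.
by rewrite !prodE ?mulgV ?letters_inv ?mem_letters0.
Qed.

Definition steps_val (W : seq step_letter) : G := (\prod_(e <- W) letter_val e)%g.

Definition spell (W : seq step_letter) : word letters := flatten (map code W).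

Lemma word_val_spell W : word_val (spell W) = steps_val W.
Proof.
elim: W => [|e W IH]; first by rewrite /word_val /steps_val !big_nil.
by rewrite /steps_val big_cons -word_val_code -/(steps_val W) -IH -word_val_cat.
Qed.

Lemma size_spell W : size (spell W) = (code_len * size W)%N.
Proof.
elim: W => [|e W IH]; first by rewrite muln0.
by rewrite -[spell _]/(code e ++ spell W) size_cat size_code IH mulnS.
Qed.

(** Cutting a word inside a block leaves a remainder of at most one block, so prefixes of words are
    controlled by prefixes of step sequences. *)
Lemma take_spell W i :
  exists2 r : word letters, (size r <= code_len)%N &
    word_val (take i (spell W)) = (steps_val (take (i %/ code_len) W) * word_val r)%g.
Proof.
elim: W i => [|e W IH] i.
  by exists [::] => //; rewrite /steps_val /word_val /= !big_nil mulg1.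
rewrite -[spell _]/(code e ++ spell W) take_cat size_code.
case: ltnP => ik.
  exists (take i (code e)); first by rewrite -(size_code e) size_take_min geq_minr.
  by rewrite divn_small // take0 /steps_val big_nil mul1g.
have [r rk rE] := IH (i - code_len)%N; exists r => //.
rewrite word_val_cat rE word_val_code.
have -> : (i %/ code_len = ((i - code_len) %/ code_len).+1)%N.
  by rewrite -[in LHS](subnK ik) divnDr ?dvdnn // divnn addn1.
by rewrite /= /steps_val big_cons mulgA.
Qed.

(** [few_moves] bounds the squares of the u- and v-coordinates by l. For c the bound |c| <= l is
    automatic, so its channel has no such test. The final disjunction bounds l from above, either by
    the square of some coordinate or through |c| = l; without it an element would have arbitrarily
    long words. *)
Definition tracks (s1 : seq A1) (s2 : seq A2) : Prop :=
  [/\ size s1 = size s2,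
      forall i, let b := map (fun f : A1 => f i) s1 in periodic b /\ few_moves b,
      forall j, let b := map (fun f : A2 => f.1 j) s2 in periodic b /\ few_moves b,
      let b := map snd s2 in periodic b /\ (~~ zok -> all (pred1 None) b) &
      [\/ exists i, many_moves (map (fun f : A1 => f i) s1),
          exists j, many_moves (map (fun f : A2 => f.1 j) s2) |
          all isSome (map snd s2)]].

Definition step_lang (W : seq step_letter) : Prop :=
  is_two_phase W /\ tracks (phase1 W) (phase2 W).

Definition lang : set (word letters) :=
  [set w | exists2 W, step_lang W & w = spell W]%classic.

Lemma rt_on_periodic : rt_on (fun=> True) periodic.
Proof. by exists period_machine => w _; exact: period_machine_accepts. Qed.

Lemma real_time_lang : g0 != 1%g -> real_time_language lang.
Proof.
move=> g0_neq1; apply: (@real_time_code _ _ code_len code step_lang) => //.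
- exact: size_code.
- exact: code_inj.
apply: real_time_rt_on; first exact: real_time_two_phase.
have chan1 (g : A1 -> M) (Q : seq M -> Prop) :
    rt_on (fun=> True) Q -> rt_on (@is_two_phase A1 A2 T) (fun W => Q (map g (phase1 W))).
  move=> HQ; apply: (@rt_on_phase1 _ _ _ (fun s => Q (map g s))).
  have H := rt_on_pmap (f := Some \o g) (D := fun=> True) (fun _ _ => I) HQ.
  by apply: rt_on_ext H => s _; rewrite (pmap_Some g).
have chan2 (g : A2 -> M) (Q : seq M -> Prop) :
    rt_on (fun=> True) Q -> rt_on (@is_two_phase A1 A2 T) (fun W => Q (map g (phase2 W))).
  move=> HQ; apply: (@rt_on_phase2 _ _ _ (fun s => Q (map g s))).
  have H := rt_on_pmap (f := Some \o g) (D := fun=> True) (fun _ _ => I) HQ.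
  by apply: rt_on_ext H => s _; rewrite (pmap_Some g).
have H1 : rt_on (@is_two_phase A1 A2 T) (fun W => forall i,
   let b := map (fun f : A1 => f i) (phase1 W) in periodic b /\ few_moves b).
  apply: rt_on_fin_forall => i; apply: rt_on_and.
    exact/chan1/rt_on_periodic.
  exact/(@rt_on_ended1 _ _ _ _ few_moves)/rt_on_few_moves.
have H2 : rt_on (@is_two_phase A1 A2 T) (fun W => forall j,
   let b := map (fun f : A2 => f.1 j) (phase2 W) in periodic b /\ few_moves b).
  apply: rt_on_fin_forall => j; apply: rt_on_and.
    exact/chan2/rt_on_periodic.
  exact/(@rt_on_ended2 _ _ _ _ few_moves)/rt_on_few_moves.
have H3 : rt_on (@is_two_phase A1 A2 T) (fun W =>
   let b := map snd (phase2 W) in periodic b /\ (~~ zok -> all (pred1 None) b)).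
  apply: rt_on_and; first exact/chan2/rt_on_periodic.
  apply: (@rt_on_ext _ _ (fun W => all (fun b => zok || (b == None)) (map snd (phase2 W)))).
    move=> W _; case: zok => //=; split=> //; last exact.
    by move=> _; apply/allP.
  exact/(chan2 _ (fun s => all _ s))/rt_on_all_pred.
have H4 : rt_on (@is_two_phase A1 A2 T) (fun W =>
    (exists i, many_moves (map (fun f : A1 => f i) (phase1 W))) \/
    (exists j, many_moves (map (fun f : A2 => f.1 j) (phase2 W)))).
  apply: rt_on_or; apply: rt_on_fin_exists => i.
    exact/(@rt_on_ended1 _ _ _ _ many_moves)/rt_on_many_moves.
  exact/(@rt_on_ended2 _ _ _ _ many_moves)/rt_on_many_moves.
have H5 : rt_on (@is_two_phase A1 A2 T) (fun W => all isSome (map snd (phase2 W))).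
  exact/(chan2 _ (fun s => all _ s))/rt_on_all_pred.
have H := rt_on_and (rt_on_and (@rt_on_size_eq A1 A2 T) (rt_on_and H1 H2))
                    (rt_on_and H3 (rt_on_or H4 H5)).
apply: rt_on_ext H => W _; split.
  move=> [[K1 [K2 K3]] [K4 [[K5|K5]|K5]]]; split=> //.
  - exact: Or31.
  - exact: Or32.
  - exact: Or33.
move=> [K1 K2 K3 K4 K5]; split; split=> //.
by case: K5 => K5; [left; left|left; right|right].
Qed.

End Combing.

(** * Words of the language described by duration, periods and signs *)

Definition coord (p : nat) (b : bool) (s : nat) : int := move_val (Some b) * (s %/ p)%:Z.

Lemma coordS p b s : (0 < p)%N -> coord p b s.+1 = coord p b s + move_val (move_at p b s).
Proof.
move=> p0; rewrite /coord divSn // PoszD mulrDr; congr (_ + _).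
by rewrite /move_at; case: ifP => _; rewrite ?mulr1 ?mulr0.
Qed.

Lemma coord0 p b : coord p b 0 = 0.
Proof. by rewrite /coord div0n mulr0. Qed.

Lemma abs_coord p b s : `|coord p b s| = (s %/ p)%:Z.
Proof. by rewrite /coord; case: b; rewrite ?mul1r ?mulN1r ?normrN. Qed.

Section Params.
Variables (G : groupType) (P : polarization G).
Variable g0 : G.

Notation n := (pn P).
Notation m := (pm P).
Notation U := {ffun 'I_n -> int}.
Notation V := {ffun 'I_m -> int}.
Notation xx := (@xx G P).
Notation yy := (@yy G P).
Notation zz := (@zz G P).
Notation zok := (zok P).
Notation M := (option bool).
Notation A1 := {ffun 'I_n -> M}.
Notation A2 := ({ffun 'I_m -> M} * M)%type.
Notation T := (seq_sub (reps P)).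
Notation lang := (@lang G P g0).
Notation spell := (@spell G P g0).

Record param := Param {
  len : nat;
  per1 : 'I_n -> nat; sg1 : 'I_n -> bool;
  per2 : 'I_m -> nat; sg2 : 'I_m -> bool;
  per3 : nat; sg3 : bool;
  rep : T
}.
Implicit Types Q : param.

(** Coordinates after [s] step letters. In what follows, truncated subtraction keeps v and c at 0
    during the first phase, and [minn] freezes u during the second. *)
Definition cU Q s : U := [ffun i => coord (per1 Q i) (sg1 Q i) (minn s (len Q))].
Definition cV Q s : V :=
  [ffun j => coord (per2 Q j) (sg2 Q j) (minn (s - len Q) (len Q))].
Definition cZ Q s : int := coord (per3 Q) (sg3 Q) (minn (s - len Q) (len Q)).

Definition letter1 Q k : A1 := [ffun i => move_at (per1 Q i) (sg1 Q i) k].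
Definition letter2 Q k : A2 :=
  ([ffun j => move_at (per2 Q j) (sg2 Q j) k], move_at (per3 Q) (sg3 Q) k).

Definition param_word Q : seq (step_letter P) :=
  two_phase (mkseq (letter1 Q) (len Q)) (mkseq (letter2 Q) (len Q)) (rep Q).

Definition slow (l p : nat) : Prop := (0 < p)%N /\ (l %/ p <= p)%N.
Definition fast (l p : nat) : Prop := (p <= l)%N /\ (p <= (2 * (l %/ p)).+2)%N.

(** What membership implies. The bound [len Q <= 1] is there because a channel without moves passes
    [many_moves] exactly for such lengths; the converse [param_lang] asks for [len Q = 0]
    instead. *)
Definition valid Q : Prop :=
  [/\ forall i, slow (len Q) (per1 Q i), forall j, slow (len Q) (per2 Q j),
      (0 < per3 Q)%N /\ (zok || (len Q < per3 Q)%N) &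
      [\/ exists i, fast (len Q) (per1 Q i), exists j, fast (len Q) (per2 Q j) |
          per3 Q = 1%N \/ (len Q <= 1)%N]].

Lemma mkseq_rcons (B : Type) (f : nat -> B) l : mkseq f l.+1 = rcons (mkseq f l) (f l).
Proof. by rewrite /mkseq -addn1 iotaD map_cat cats1. Qed.

Lemma take_mkseq (B : Type) (f : nat -> B) s l : take s (mkseq f l) = mkseq f (minn s l).
Proof. by rewrite /mkseq -map_take take_iota. Qed.

Lemma steps_val_cat (W W' : seq (step_letter P)) :
  steps_val (W ++ W') = (steps_val W * steps_val W')%g.
Proof. by rewrite /steps_val big_cat. Qed.

Lemma steps_val1 (e : step_letter P) : steps_val [:: e] = letter_val e.
Proof. by rewrite /steps_val big_seq1. Qed.

Lemma phase1_val Q l : valid Q ->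
  steps_val (map (inl \o inl) (mkseq (letter1 Q) l) : seq (step_letter P)) =
  xx [ffun i => coord (per1 Q i) (sg1 Q i) l].
Proof.
move=> [v1 _ _ _]; elim: l => [|l IH].
  rewrite /steps_val big_nil -(hom0 (@xxD _ P)); congr xx.
  by apply/ffunP => i; rewrite !ffunE coord0.
rewrite mkseq_rcons map_rcons -cats1 steps_val_cat IH steps_val1 /= -xxD; congr xx.
by apply/ffunP => i; rewrite !ffunE coordS //; have [] := v1 i.
Qed.

Lemma phase2_val Q l : valid Q ->
  steps_val (map (inl \o inr) (mkseq (letter2 Q) l) : seq (step_letter P)) =
  (yy [ffun j => coord (per2 Q j) (sg2 Q j) l] * zz (coord (per3 Q) (sg3 Q) l))%g.
Proof.
move=> [_ v2 [v3 _] _]; elim: l => [|l IH].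
  rewrite /steps_val big_nil coord0 (hom0 (@zzD _ P)) mulg1 -(hom0 (@yyD _ P)); congr yy.
  by apply/ffunP => i; rewrite !ffunE coord0.
rewrite mkseq_rcons map_rcons -cats1 steps_val_cat IH steps_val1 /= coordS // zzD.
rewrite !mulgA -(mulgA (yy _) (zz _) (yy _)) [(zz _ * yy _)%g]zzC !mulgA -yyD.
congr (yy _ * _ * _)%g.
by apply/ffunP => i; rewrite !ffunE coordS //; have [] := v2 i.
Qed.

Lemma param_word_val Q s : valid Q ->
  steps_val (take s (param_word Q)) =
  (point (cU Q s) (cV Q s) (cZ Q s) * (if (s <= 2 * len Q)%N then 1 else val (rep Q)))%g.
Proof.
move=> vQ; rewrite /param_word /two_phase -cats1 -catA take_cat size_map size_mkseq.
rewrite /point; case: ltnP => sl.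
  have s0 : (s - len Q = 0)%N by lia.
  have -> : cV Q s = 0 by apply/ffunP => j; rewrite !ffunE s0 min0n coord0.
  have -> : cZ Q s = 0 by rewrite /cZ s0 min0n coord0.
  rewrite (hom0 (@yyD _ P)) (hom0 (@zzD _ P)) ifT ?mulg1; last lia.
  by rewrite -map_take take_mkseq phase1_val.
have -> : cU Q s = [ffun i => coord (per1 Q i) (sg1 Q i) (len Q)].
  by apply/ffunP => i; rewrite !ffunE (minn_idPr sl).
rewrite steps_val_cat phase1_val // -!mulgA; congr (_ * _)%g.
rewrite take_cat size_map size_mkseq; case: ltnP => sl2.
  rewrite -map_take take_mkseq phase2_val // ifT ?mulg1; last lia.
  by congr (yy _ * _)%g; apply/ffunP => j; rewrite !ffunE.
rewrite steps_val_cat phase2_val // mulgA; congr (_ * _)%g.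
  rewrite /cZ (minn_idPr sl2); congr (yy _ * _)%g.
  by apply/ffunP => j; rewrite !ffunE (minn_idPr sl2).
case: leqP => s2.
  by rewrite (_ : _ - _ - _ = 0)%N ?take0 /steps_val ?big_nil //; lia.
have -> : (s - len Q - len Q = (s - len Q - len Q).-1.+1)%N by lia.
by rewrite /= steps_val1.
Qed.

Lemma size_param_word Q : size (param_word Q) = (2 * len Q).+1.
Proof. by rewrite size_rcons size_cat !size_map !size_iota mul2n addnn. Qed.

Lemma chan1E Q i :
  map (fun f : A1 => f i) (mkseq (letter1 Q) (len Q)) =
  periodic_moves (per1 Q i) (sg1 Q i) (len Q).
Proof. by rewrite /mkseq -map_comp; apply: eq_map => k /=; rewrite ffunE. Qed.

Lemma chan2E Q j :
  map (fun f : A2 => f.1 j) (mkseq (letter2 Q) (len Q)) =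
  periodic_moves (per2 Q j) (sg2 Q j) (len Q).
Proof. by rewrite /mkseq -map_comp; apply: eq_map => k /=; rewrite ffunE. Qed.

Lemma chan3E Q :
  map snd (mkseq (letter2 Q) (len Q)) = periodic_moves (per3 Q) (sg3 Q) (len Q).
Proof. by rewrite /mkseq -map_comp; apply: eq_map. Qed.

Lemma param_lang Q : valid Q ->
  [\/ exists i, fast (len Q) (per1 Q i), exists j, fast (len Q) (per2 Q j) |
      per3 Q = 1%N \/ len Q = 0%N] ->
  lang (spell (param_word Q)).
Proof.
move=> [v1 v2 [v3 vz] _] vm; exists (param_word Q) => //; split.
  by exists (mkseq (letter1 Q) (len Q)), (mkseq (letter2 Q) (len Q)), (rep Q).
rewrite phase1_two_phase phase2_two_phase; split.
- by rewrite !size_mkseq.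
- move=> i; rewrite /= chan1E; have [p0 lp] := v1 i.
  by split; [exact: periodic_movesW|rewrite few_periodic].
- move=> j; rewrite /= chan2E; have [p0 lp] := v2 j.
  by split; [exact: periodic_movesW|rewrite few_periodic].
- rewrite /= chan3E; split; first exact: periodic_movesW.
  by move=> nz; rewrite no_moves_periodic //; rewrite (negbTE nz) in vz.
- case: vm => [[i [f1 f2]]|[j [f1 f2]]|f3].
  + by apply: Or31; exists i; rewrite chan1E many_periodic ?f1 //; have [] := v1 i.
  + by apply: Or32; exists j; rewrite chan2E many_periodic ?f1 //; have [] := v2 j.
  + apply: Or33; rewrite chan3E all_moves_periodic //.
    by case: f3 => ->; rewrite eqxx ?orbT.
Qed.

Lemma lang_param (w : word (letters P g0)) :
  lang w -> exists2 Q, valid Q & w = spell (param_word Q).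
Proof.
move=> [W [[s1 [s2 [t ->]]]]]; rewrite phase1_two_phase phase2_two_phase.
move=> [ss H1 H2 [H3 H4] H5] ->.
have /fin_all_exists[pb1 pb1E] i : exists pb : nat * bool, (0 < pb.1)%N /\
    map (fun f : A1 => f i) s1 = periodic_moves pb.1 pb.2 (size s1).
  have [/periodic_movesP[p p0 [b bE]] _] := H1 i.
  by exists (p, b); split=> //; rewrite bE size_map.
have /fin_all_exists[pb2 pb2E] j : exists pb : nat * bool, (0 < pb.1)%N /\
    map (fun f : A2 => f.1 j) s2 = periodic_moves pb.1 pb.2 (size s1).
  have [/periodic_movesP[p p0 [b bE]] _] := H2 j.
  by exists (p, b); split=> //; rewrite bE size_map ss.
have [p3 p30 [b3 b3E]] := periodic_movesP H3; rewrite size_map -ss in b3E.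
pose Q := Param (size s1) (fun i => (pb1 i).1) (fun i => (pb1 i).2)
  (fun j => (pb2 j).1) (fun j => (pb2 j).2) p3 b3 t.
have s1E : s1 = mkseq (letter1 Q) (len Q).
  case: s1 @Q pb1E {ss H1 H5 pb2E b3E} => [|a0 s1] Q pb1E //.
  apply: (@eq_from_nth _ a0) => [|k ks]; first by rewrite size_mkseq.
  rewrite nth_mkseq //; apply/ffunP => i; rewrite ffunE.
  have [_ /(congr1 (fun s => nth None s k))] := pb1E i.
  by rewrite (nth_map a0) // nth_mkseq.
have s2E : s2 = mkseq (letter2 Q) (len Q).
  case: s2 @Q pb2E b3E ss {H2 H3 H4 H5 s1E} => [|a0 s2] Q pb2E b3E ss.
    by rewrite /len /Q ss.
  apply: (@eq_from_nth _ a0) => [|k ks]; first by rewrite size_mkseq.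
  have ks1 : (k < size s1)%N by rewrite ss.
  rewrite nth_mkseq //; set a := nth _ _ _.
  suff [a1 a2] : (forall j, a.1 j = (letter2 Q k).1 j) /\ a.2 = (letter2 Q k).2.
    by case: a a1 a2 => a1 a2 /= /ffunP -> ->.
  split=> [j|]; last first.
    by have /(congr1 (fun s => nth None s k)) := b3E; rewrite (nth_map a0) // nth_mkseq.
  have [_ /(congr1 (fun s => nth None s k))] := pb2E j.
  by rewrite (nth_map a0) // nth_mkseq // ffunE.
exists Q; last by rewrite /param_word -s1E -s2E.
split.
- move=> i; have [p0 pE] := pb1E i; split=> //.
  by rewrite -(few_periodic (pb1 i).2) // -pE; have [] := H1 i.
- move=> j; have [p0 pE] := pb2E j; split=> //.
  by rewrite -(few_periodic (pb2 j).2) // -pE; have [] := H2 j.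
- split=> //; case: (boolP zok) => //= nz.
  by rewrite -(no_moves_periodic b3) // -b3E H4.
- have ff p b : (0 < p)%N -> many_moves (periodic_moves p b (size s1)) ->
     fast (size s1) p \/ (size s1 <= 1)%N.
    by move=> p0; rewrite many_periodic //; case: ifP => [pl fp|_]; [left|right].
  case: H5 => [[i]|[j]|].
  + have [p0 ->] := pb1E i => /ff[//|f|f]; last by apply: Or33; right.
    by apply: Or31; exists i.
  + have [p0 ->] := pb2E j => /ff[//|f|f]; last by apply: Or33; right.
    by apply: Or32; exists j.
  + rewrite b3E all_moves_periodic // => /orP[/eqP f|/eqP f]; apply: Or33; first by left.
    by right; rewrite leq_eqVlt ltnS leqn0 -[len Q]/(size s1) f orbT.
Qed.

Lemma exists_param u v c (t : T) : zok || (c == 0) ->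
  exists Q, [/\ valid Q, lang (spell (param_word Q)), rep Q = t &
    [/\ cU Q (2 * len Q) = u, cV Q (2 * len Q) = v & cZ Q (2 * len Q) = c]].
Proof.
move=> cok.
pose a (k : 'I_n + 'I_m) : nat := match k with inl i => absz (u i) | inr j => absz (v j) end.
have [l [p [r [Hp r0 lr Hm]]]] := exists_length a (absz c).
have coordE (x : int) q : (l %/ q)%N = absz x -> coord q (0 <= x) l = x.
  by rewrite /coord => ->; case: (lerP 0 x) => x0 /=; lia.
pose Q := Param l (fun i => p (inl i)) (fun i => 0 <= u i)
                 (fun j => p (inr j)) (fun j => 0 <= v j) r (0 <= c) t.
have fastQ : [\/ exists i, fast (len Q) (per1 Q i), exists j, fast (len Q) (per2 Q j) |
      per3 Q = 1%N \/ len Q = 0%N].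
  case: Hm => [[[i|j] k1 k2]|]; last exact: Or33.
    by apply: Or31; exists i; split=> //=; have [_ -> _] := Hp (inl i).
  by apply: Or32; exists j; split=> //=; have [_ -> _] := Hp (inr j).
have validQ : valid Q.
  split=> //=.
  - by move=> i; have [h1 h2 h3] := Hp (inl i); split; rewrite // h2.
  - by move=> i; have [h1 h2 h3] := Hp (inr i); split; rewrite // h2.
  - split=> //; case/orP: cok => [->//|/eqP c0]; apply/orP; right.
    by rewrite ltnNge -(divn_gt0 _ r0) lr c0.
  - case: fastQ => [f|f|[f|f]]; [exact: Or31|exact: Or32|by apply: Or33; left|].
    by apply: Or33; right; move: f => /= ->.
have [c1 c2] : minn (2 * l) l = l /\ minn (2 * l - l) l = l by lia.
exists Q; split=> //; first exact: param_lang.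
split; first by apply/ffunP => i; rewrite ffunE c1 coordE //; have [] := Hp (inl i).
  by apply/ffunP => j; rewrite ffunE c2 coordE //; have [] := Hp (inr j).
by rewrite /cZ c2 coordE.
Qed.

End Params.

(** * Estimates *)

Section FloorEstimates.
Variable R : realFieldType.

(* Periodic motion is nearly straight, whatever the period. *)
Lemma floor_straight (s l p : nat) : (0 < p)%N -> (s <= l)%N ->
  `|(s %/ p)%:R - s%:R / l.+1%:R * (l %/ p)%:R| <= 1 :> R.
Proof.
move=> p0 sl.
(* Multiplied by [p], the difference [l.+1 * (s %/ p) - s * (l %/ p)] becomes
   [s * (l %% p).+1 - l.+1 * (s %% p)], and both terms lie between 0 and [l.+1 * p]. *)
have key : (l.+1 * (s %/ p) <= l.+1 + s * (l %/ p))%N /\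
           (s * (l %/ p) <= l.+1 + l.+1 * (s %/ p))%N.
  have h1 : (s * (l %% p).+1 <= l * p)%N by apply: leq_mul => //; rewrite ltn_mod.
  have h2 : (l.+1 * (s %% p) <= l.+1 * p)%N.
    by rewrite leq_mul2l ltnW ?orbT ?ltn_mod.
  suff : (l.+1 * (s %/ p) * p <= (l.+1 + s * (l %/ p)) * p)%N /\
         (s * (l %/ p) * p <= (l.+1 + l.+1 * (s %/ p)) * p)%N by rewrite !leq_pmul2r.
  move: h1 h2 (divn_eq s p) (divn_eq l p).
  move: (s %/ p)%N (s %% p)%N (l %/ p)%N (l %% p)%N => x r a t + + sE lE.
  rewrite {}sE {}lE {p0 sl}; move=> h1 h2.
  have [h3 h4] : (0 <= a * r * p)%N /\ (0 <= r * t)%N by [].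
  by split; lia.
have l0 : 0 < l.+1%:R :> R by rewrite ltr0n.
rewrite -(ler_pM2l l0) -[X in X * `|_|](ger0_norm (ltW l0)) -normrM mulrBr mulr1.
have -> : l.+1%:R * (s%:R / l.+1%:R * (l %/ p)%:R) = s%:R * (l %/ p)%:R :> R.
  by move: (l.+1%:R : R) (lt0r_neq0 l0) => y ?; field.
rewrite ler_norml; case: key => k1 k2.
have {}k1 : (l.+1%:R * (s %/ p)%:R <= l.+1%:R + s%:R * (l %/ p)%:R :> R).
  by rewrite -!natrM -natrD ler_nat.
have {}k2 : (s%:R * (l %/ p)%:R <= l.+1%:R + l.+1%:R * (s %/ p)%:R :> R).
  by rewrite -!natrM -natrD ler_nat.
by lra.
Qed.

(** Rounding costs 1. The uncertainty 3 in time costs at most 3 in space, because the speed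
    [(l %/ p) / l.+1] is at most 1. *)
Lemma coord_straight (p : nat) (b : bool) (s l : nat) (tau : R) :
  (0 < p)%N -> (s <= l)%N -> `|s%:R - tau * l.+1%:R| <= 3 ->
  `|(coord p b s)%:~R - tau * (coord p b l)%:~R| <= 4 :> R.
Proof.
move=> p0 sl tauP; rewrite /coord !intrM mulrCA -mulrBr normrM.
have -> : `|(move_val (Some b))%:~R| = 1 :> R by case: b; rewrite /= ?normr1 // normrN1.
rewrite mul1r !pmulrn -!pmulrn.
have l0 : 0 < l.+1%:R :> R by rewrite ltr0n.
have F := floor_straight p0 sl.
have al : (l %/ p)%:R <= l.+1%:R :> R by rewrite ler_nat (leq_trans (leq_div _ _)).
have E : `|s%:R / l.+1%:R * (l %/ p)%:R - tau * (l %/ p)%:R| <= 3 :> R.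
  have -> : s%:R / l.+1%:R * (l %/ p)%:R - tau * (l %/ p)%:R =
     (s%:R - tau * l.+1%:R) * ((l %/ p)%:R / l.+1%:R) :> R.
    by move: (l.+1%:R : R) (lt0r_neq0 l0) => y ?; field.
  rewrite normrM -[3]mulr1; apply: ler_pM => //.
  by rewrite ger0_norm ?ler_pdivrMr ?mul1r // divr_ge0.
rewrite -(subrK (s%:R / l.+1%:R * (l %/ p)%:R) (s %/ p)%:R) -addrA.
by apply: le_trans (ler_normD _ _) _; lra.
Qed.

End FloorEstimates.

Section Bounds.
Variables (G : groupType) (P : polarization G).
Variable g0 : G.

Notation n := (pn P).
Notation m := (pm P).
Notation U := {ffun 'I_n -> int}.
Notation V := {ffun 'I_m -> int}.
Notation zz := (@zz G P).
Notation zok := (zok P).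
Notation omega := (pairing (pw (p:=P))).
Notation letters := (letters P g0).
Implicit Types (u : U) (v : V) (c : int) (C : nat).

Definition bounded C u v c : Prop :=
  [/\ forall i, `|u i| <= C%:Z, forall j, `|v j| <= C%:Z & `|c| <= C%:Z].

Lemma boundedW C C' u v c : (C <= C')%N -> bounded C u v c -> bounded C' u v c.
Proof.
move=> CC' [bu bv bc]; have CC : C%:Z <= C'%:Z by lia.
by split=> [i|j|]; apply: le_trans CC.
Qed.

Lemma exists_bounded u v c : exists C, bounded C u v c.
Proof.
exists (\sum_i absz (u i) + \sum_j absz (v j) + absz c)%N; split.
- move=> i; rewrite (bigD1 i) //=; lia.
- move=> j; rewrite [X in (_ + X + _)%N](bigD1 j) //=; lia.
- lia.
Qed.

(** By [point_inj] each element of [F] has at most one admissible triple of coordinates. This turns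
    finiteness statements in the group into coordinate bounds without computing any coordinates. *)
Lemma bounded_finite (F : seq G) : exists C, forall u v c, zok || (c == 0) ->
  point u v c \in F -> bounded C u v c.
Proof.
elim: F => [|g F [C IH]]; first by exists 0%N.
have [[u [v [c [cok gE]]]]|nog] := pselect (exists u v c, zok || (c == 0) /\ point u v c = g).
  have [C' bC'] := exists_bounded u v c.
  exists (maxn C C') => u' v' c' c'ok; rewrite inE => /orP[/eqP|/IH b].
    rewrite -gE => E; have [-> -> ->] := point_inj c'ok cok E.
    by apply: boundedW bC'; exact: leq_maxr.
  by apply: boundedW (b c'ok); exact: leq_maxl.
exists C => u v c cok; rewrite inE => /orP[/eqP gE|/IH]; last exact.
by case: nog; exists u, v, c.
Qed.

Definition sign_move (x : int) : option bool := if x == 0 then None else Some (0 < x).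

Lemma sign_moveP (x : int) C : `|x| <= C.+1%:Z -> `|x - move_val (sign_move x)| <= C%:Z.
Proof.
rewrite /sign_move; case: eqP => [->|x0] /=; first by rewrite subr0 normr0; lia.
by case: ltrP => /= ? ?; lia.
Qed.

(** A letter moves every coordinate towards its target simultaneously, hence length [C] whatever the
    number of coordinates. *)
Lemma hom_word (I : finType) (f : {ffun I -> int} -> G) :
  (forall a b, f (a + b) = (f a * f b)%g) ->
  (forall e : {ffun I -> option bool}, f [ffun i => move_val (e i)] \in letters) ->
  forall C (a : {ffun I -> int}), (forall i, `|a i| <= C%:Z) ->
  exists2 r : word letters, (size r <= C)%N & word_val r = f a.
Proof.
move=> fD fX; elim=> [|C IH] a aC.
  exists [::] => //; rewrite /word_val big_nil.
  have -> : a = 0 by apply/ffunP => i; rewrite ffunE; have := aC i; lia.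
  by rewrite hom0.
pose e : {ffun I -> option bool} := [ffun i => sign_move (a i)].
pose b : {ffun I -> int} := [ffun i => move_val (e i)].
have [|r rC rE] := IH (a - b).
  by move=> i; rewrite !ffunE; exact: sign_moveP.
exists (rcons r (to_letter P g0 (f b))); first by rewrite size_rcons.
by rewrite -cats1 word_val_cat rE /word_val big_seq1 to_letterK; [rewrite -fD subrK|exact: fX].
Qed.

Lemma bounded_word C u v c : bounded C u v c ->
  exists2 r : word letters, (size r <= 3 * C)%N & word_val r = point u v c.
Proof.
move=> [bu bv bc].
have [|ru ruC ruE] := hom_word (@xxD _ P) _ bu.
  by move=> e; have := mem_letter_val g0 (inl (inl e) : step_letter P).
have [|rv rvC rvE] := hom_word (@yyD _ P) _ bv.
  move=> e; have := mem_letter_val g0 (inl (inr (e, None)) : step_letter P).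
  by rewrite /= (hom0 (@zzD _ P)) mulg1.
have [|||rc rcC rcE] := @hom_word unit (fun a => zz (a tt)) _ _ C [ffun=> c].
- by move=> a b; rewrite ffunE zzD.
- move=> e; have := mem_letter_val g0 (inl (inr ([ffun=> None], e tt)) : step_letter P).
  rewrite /= (_ : [ffun j => _] = 0) ?(hom0 (@yyD _ P)) ?mul1g ?ffunE //.
  by apply/ffunP => j; rewrite !ffunE.
- by move=> i; rewrite ffunE.
exists (ru ++ rv ++ rc); first by rewrite !size_cat; lia.
by rewrite !word_val_cat ruE rvE rcE ffunE mulgA.
Qed.

Definition pairing_norm : nat := \sum_i \sum_j absz (@pw G P i j).

Lemma pairing_bound (R : realFieldType) (x : 'I_n -> R) (y : 'I_m -> R) (a b : R) :
  (forall i, `|x i| <= a) -> (forall j, `|y j| <= b) ->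
  `|\sum_i \sum_j x i * y j * (@pw G P i j)%:~R| <= pairing_norm%:R * a * b.
Proof.
move=> xa yb; rewrite /pairing_norm natr_sum !mulr_suml.
apply: le_trans (ler_norm_sum _ _ _) _; apply: ler_sum => i _.
rewrite natr_sum !mulr_suml.
apply: le_trans (ler_norm_sum _ _ _) _; apply: ler_sum => j _.
rewrite !normrM.
have -> : `|(pw i j)%:~R| = (absz (@pw G P i j))%:R :> R.
  by rewrite -intr_norm -abszE -pmulrn.
by rewrite mulrC -[leRHS]mulrA; apply: ler_wpM2l => //; apply: ler_pM.
Qed.

Lemma pairingE (R : realFieldType) u v :
  (omega u v)%:~R = \sum_i \sum_j (u i)%:~R * (v j)%:~R * (@pw G P i j)%:~R :> R.
Proof.
rewrite /pairing rmorph_sum; apply: eq_bigr => i _.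
by rewrite rmorph_sum; apply: eq_bigr => j _; rewrite /= !intrM.
Qed.

Lemma pairing_intbound u v (a b : nat) :
  (forall i, `|u i| <= a%:Z) -> (forall j, `|v j| <= b%:Z) ->
  `|omega u v| <= (pairing_norm * a * b)%:Z.
Proof.
move=> ua vb; rewrite -(ler_int rat) intr_norm pairingE -pmulrn !natrM.
by apply: pairing_bound => k; rewrite -intr_norm pmulrn ler_int.
Qed.

(** By [point_div] these are the coordinates of the left quotient of the two points. *)
Definition close C u v c u' v' c' : Prop :=
  bounded C (u' - u) (v' - v) (c' - c + omega (u' - u) v).

Notation param := (param P).
Implicit Types Q : param.
Notation cUe Q := (cU Q (2 * len Q)).
Notation cVe Q := (cV Q (2 * len Q)).
Notation cZe Q := (cZ Q (2 * len Q)).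

Lemma cUeE Q i : cUe Q i = coord (per1 Q i) (sg1 Q i) (len Q).
Proof. by rewrite ffunE (minn_idPr _) //; lia. Qed.

Lemma cVeE Q j : cVe Q j = coord (per2 Q j) (sg2 Q j) (len Q).
Proof. by rewrite ffunE (minn_idPr _) //; lia. Qed.

Lemma cZeE Q : cZe Q = coord (per3 Q) (sg3 Q) (len Q).
Proof. by rewrite /cZ (minn_idPr _) //; lia. Qed.

Lemma slow_sqr l p : slow l p -> ((l %/ p) ^ 2 <= l)%N.
Proof.
move=> [p0 lp]; rewrite -mulnn; apply: leq_trans (leq_divM l p).
by rewrite leq_mul2l lp orbT.
Qed.

Lemma fast_sqr l p : (0 < p)%N -> fast l p -> (l < 2 * (l %/ p).+1 ^ 2)%N.
Proof.
move=> p0 [_ lp]; apply: leq_trans (ltn_ceil l p0) _.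
by rewrite -mulnn mulnCA leq_mul2l; apply/orP; right; lia.
Qed.

Lemma len_upper Q (X Y : nat) : valid Q ->
  (forall i, `|cUe Q i| <= X%:Z) -> (forall j, `|cVe Q j| <= X%:Z) ->
  `|cZe Q| <= Y%:Z -> (len Q <= 2 * X.+1 ^ 2 + Y + 1)%N.
Proof.
move=> [v1 v2 [v3 _] vm] bu bv bc.
have F p : (0 < p)%N -> fast (len Q) p -> (len Q %/ p <= X)%N ->
    (len Q <= 2 * X.+1 ^ 2 + Y + 1)%N.
  move=> p0 /(fast_sqr p0) H H'.
  have : (2 * (len Q %/ p).+1 ^ 2 <= 2 * X.+1 ^ 2)%N by rewrite leq_mul2l leq_exp2r.
  by lia.
case: vm => [[i f]|[j f]|[c1|]]; last lia.
- by apply: F f _; [have [] := v1 i|have := bu i; rewrite cUeE abs_coord; lia].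
- by apply: F f _; [have [] := v2 j|have := bv j; rewrite cVeE abs_coord; lia].
- by move: bc; rewrite cZeE abs_coord c1 divn1; lia.
Qed.

Lemma ends_bound Q : valid Q ->
  [/\ forall i, (absz (cUe Q i) ^ 2 <= len Q)%N,
      forall j, (absz (cVe Q j) ^ 2 <= len Q)%N & (absz (cZe Q) <= len Q)%N].
Proof.
have abszE' p b l : absz (coord p b l) = (l %/ p)%N.
  by apply/eqP; rewrite -eqz_nat abszE abs_coord.
move=> [v1 v2 [v3 _] _]; split=> [i|j|].
- by rewrite cUeE abszE' slow_sqr.
- by rewrite cVeE abszE' slow_sqr.
- by rewrite cZeE abszE' leq_div.
Qed.

Lemma ffunB (I : finType) (a b : {ffun I -> int}) i : (a - b) i = a i - b i.
Proof. by rewrite !ffunE. Qed.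

Lemma absz_coord p b l : absz (coord p b l) = (l %/ p)%N.
Proof. by apply/eqP; rewrite -eqz_nat abszE abs_coord. Qed.

(** A fast coordinate, or |c|, bounds [len Q], and closeness compares it with the corresponding
    coordinate of [Q']. For c the shear intervenes, but it is linear in v with |v_j| at most
    [len Q' + C], so it is absorbed by a multiple of [(len Q').+1]. The two summands of the constant
    serve these two cases. *)
Lemma len_ratio C : exists M, forall Q Q', valid Q -> valid Q' ->
  close C (cUe Q) (cVe Q) (cZe Q) (cUe Q') (cVe Q') (cZe Q') ->
  ((len Q).+1 <= M * (len Q').+1)%N.
Proof.
exists (4 * C.+1 ^ 2 + (2 + C + pairing_norm * C * C.+1))%N => Q Q' vQ vQ' [bu bv bc].
have [eu ev ec] := ends_bound vQ'.
have v'C j : `|cVe Q j| <= (len Q' + C)%N%:Z.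
  have := bv j; have := ev j; rewrite ffunB.
  move: (cVe Q' j) (cVe Q j) => a b a2 ab.
  have : (absz a <= absz a ^ 2)%N by case: (absz a) => // k; rewrite -mulnn leq_pmulr.
  by lia.
have [v1 v2 [v3 _] vm] := vQ.
have F p (x : int) : (0 < p)%N -> fast (len Q) p -> (len Q %/ p <= absz x + C)%N ->
   (absz x ^ 2 <= len Q')%N -> ((len Q).+1 <= 4 * C.+1 ^ 2 * (len Q').+1)%N.
  move=> p0 /(fast_sqr p0) f xC x2.
  have f2 : (2 * (len Q %/ p).+1 ^ 2 <= 2 * (absz x + C.+1) ^ 2)%N.
    by rewrite leq_mul2l leq_exp2r //=; lia.
  have f3 : (2 * (absz x + C.+1) ^ 2 <= 4 * (absz x ^ 2 + C.+1 ^ 2))%N.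
    rewrite -[4%N]/(2 * 2)%N -mulnA leq_mul2l /=.
    by have [h _] := nat_Cauchy (absz x) C.+1; rewrite sqrnD; lia.
  have f4 : (4 * (absz x ^ 2 + C.+1 ^ 2) <= 4 * C.+1 ^ 2 * (len Q').+1)%N.
    rewrite -mulnA leq_mul2l /= mulnS addnC leq_add2l.
    by apply: leq_trans x2 _; rewrite leq_pmull // expn_gt0.
  by lia.
have mono a b (x : nat) : (a <= b * x)%N -> forall d, (a <= (b + d) * x)%N.
  by move=> ab d; rewrite mulnDl; lia.
case: vm => [[i f]|[j f]|[c1|l1]].
- apply: mono; have [p0 _] := v1 i; apply: F f _ (eu i) => //.
  have := bu i; rewrite ffunB [cUe Q i]cUeE -(absz_coord _ (sg1 Q i)).
  by move: (cUe Q' i) (coord _ _ _) => x y; lia.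
- apply: mono; have [p0 _] := v2 j; apply: F f _ (ev j) => //.
  have := bv j; rewrite ffunB [cVe Q j]cVeE -(absz_coord _ (sg2 Q j)).
  by move: (cVe Q' j) (coord _ _ _) => x y; lia.
- have := pairing_intbound bu v'C; move: bc ec.
  rewrite [cZe Q]cZeE; have := absz_coord (per3 Q) (sg3 Q) (len Q); rewrite c1 divn1.
  move: (coord _ _ _) (cZe Q') (omega _ _) (pairing_norm * C)%N => x y o W.
  move=> xl xyo yl oW; have {}oW : `|o| <= (W * C.+1 * (len Q').+1)%N%:Z.
    apply: le_trans oW _; rewrite lez_nat -mulnA leq_mul2l; apply/orP; right; lia.
  rewrite addnC mulnDl; apply: leq_trans (leq_addr _ _); rewrite !mulnDl.
  move: (W * C.+1 * (len Q').+1)%N oW => z oz; rewrite mulnS; lia.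
- by rewrite addnC !mulnDl; lia.
Qed.

End Bounds.

Section Travel.
Variables (G : groupType) (P : polarization G).

Notation omega := (pairing (pw (p:=P))).
Notation param := (param P).
Implicit Types (Q : param) (C : nat).
Notation cUe Q := (cU Q (2 * len Q)).
Notation cVe Q := (cV Q (2 * len Q)).
Notation cZe Q := (cZ Q (2 * len Q)).
Notation N := (pairing_norm P).

Section Straight.
Variable R : realFieldType.
Implicit Types th : R.

(** [th] is time normalized so that each phase lasts one unit; [t1] and [t2] are the fractions of
    the two phases already run. Passing from error 2 to 3 pays for [len Q] against [(len Q).+1] at
    the change of phase. *)
Lemma pos_straight Q s th : valid Q -> 0 <= th <= 2 ->
  `|s%:R - th * (len Q).+1%:R| <= 2 ->
  exists t1 t2 : R,
    [/\ t1 = Num.min th 1, t2 = Num.max (th - 1) 0,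
        `|(minn (s - len Q) (len Q))%:R - t2 * (len Q).+1%:R| <= 3 &
     [/\ forall i, `|(cU Q s i)%:~R - t1 * (cUe Q i)%:~R| <= 4,
         forall j, `|(cV Q s j)%:~R - t2 * (cVe Q j)%:~R| <= 4 &
         `|(cZ Q s)%:~R - t2 * (cZe Q)%:~R| <= 4]].
Proof.
move=> [v1 v2 [v3 _] _] /andP[th0 th2] sth.
exists (Num.min th 1), (Num.max (th - 1) 0).
have l0 : 0 < (len Q).+1%:R :> R by rewrite ltr0n.
have lS : (len Q).+1%:R = (len Q)%:R + 1 :> R by rewrite -natr1.
have E1 : `|(minn s (len Q))%:R - Num.min th 1 * (len Q).+1%:R| <= 3 :> R.
  case: (leqP s (len Q)) => sl.
    have {}sl : s%:R <= (len Q)%:R :> R by rewrite ler_nat.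
    move: sth; rewrite !ler_norml; case: (lerP th 1) => t1; rewrite ?mul1r; first by lra.
    have : (len Q).+1%:R <= th * (len Q).+1%:R by rewrite ler_peMl // ltW.
    by lra.
  have {}sl : (len Q).+1%:R <= s%:R :> R by rewrite ler_nat.
  move: sth; rewrite !ler_norml; case: (lerP th 1) => t1; rewrite ?mul1r.
    have : th * (len Q).+1%:R <= (len Q).+1%:R by rewrite ler_piMl // ltW.
    by lra.
  by lra.
have E2 : `|(minn (s - len Q) (len Q))%:R - Num.max (th - 1) 0 * (len Q).+1%:R| <= 3 :> R.
  have tE : (th - 1) * (len Q).+1%:R = th * (len Q).+1%:R - (len Q).+1%:R by rewrite mulrBl mul1r.
  have h2 : (th - 1) * (len Q).+1%:R <= (len Q).+1%:R by rewrite ler_piMl ?(ltW l0) //; lra.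
  have mE : (minn (s - len Q) (len Q))%:R =
      Num.max (Num.min (s%:R - (len Q)%:R) (len Q)%:R) 0 :> R.
    have lQ0 : 0 <= (len Q)%:R :> R by [].
    case: (leqP s (len Q)) => sl.
      rewrite (_ : s - len Q = 0)%N ?min0n; last by lia.
      have : s%:R <= (len Q)%:R :> R by rewrite ler_nat.
      move=> ?; case: (lerP (s%:R - (len Q)%:R) (len Q)%:R) => ?; last by lra.
      by rewrite max_r // subr_le0.
    have sl' : (len Q)%:R <= s%:R :> R by rewrite ler_nat ltnW.
    rewrite -(natrB _ (ltnW sl)).
    case: (leqP (s - len Q) (len Q)) => sl2.
      by rewrite min_l ?max_l // ler_nat.
    by rewrite min_r ?max_l // ler_nat ltnW.
  rewrite mE; move: sth h2 tE; rewrite lS.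
  move: (len Q)%:R (ler0n R (len Q)) => l lpos.
  rewrite !ler_norml.
  case: (lerP (th - 1) 0) => t1; rewrite ?mul0r.
    have h3 : th * (l + 1) <= (l + 1) by rewrite ler_piMl //; lra.
    case: (lerP (s%:R - l) l) => ?; [case: (lerP (s%:R - l) 0)|case: (lerP l 0)] => ?; lra.
  have h3 : 0 <= (th - 1) * (l + 1) by apply: mulr_ge0; lra.
  case: (lerP (s%:R - l) l) => ?; [case: (lerP (s%:R - l) 0)|case: (lerP l 0)] => ?; lra.
split=> //; split.
- move=> i; rewrite cUeE ffunE; apply: coord_straight => //; last exact: geq_minr.
  by have [] := v1 i.
- move=> j; rewrite cVeE ffunE; apply: coord_straight => //; last exact: geq_minr.
  by have [] := v2 j.
- by rewrite cZeE; apply: coord_straight => //; exact: geq_minr.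
Qed.

Lemma dist_scaled (x y a b t D : R) : 0 <= t <= 1 ->
  `|x - t * a| <= 4 -> `|y - t * b| <= 4 -> `|b - a| <= D -> `|y - x| <= D + 8.
Proof.
move=> /andP[t0 t1] xa yb ab.
have : `|t * (b - a)| <= D.
  rewrite normrM (ger0_norm t0); apply: le_trans ab.
  by rewrite ler_piMl.
rewrite mulrBr; move: xa yb; rewrite !ler_norml; move: (t * a) (t * b) => u v; lra.
Qed.

Lemma small_scaled (x a t l l' M : R) : 0 <= t -> 0 <= M -> `|x - t * a| <= 4 ->
  `|a| <= l' -> l' <= M * l -> t * l <= 3 -> `|x| <= 4 + 3 * M.
Proof.
move=> t0 M0 xa al l'l tl.
have : `|t * a| <= 3 * M.
  rewrite normrM (ger0_norm t0); apply: le_trans (ler_wpM2l t0 (le_trans al l'l)) _.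
  by rewrite mulrCA mulrC ler_wpM2r.
move: xa; rewrite !ler_norml; move: (t * a) => u; lra.
Qed.

End Straight.

Lemma early_pos Q s : (s < len Q)%N -> cV Q s = 0 /\ cZ Q s = 0.
Proof.
move=> sl; have s0 : (s - len Q = 0)%N by lia.
by split; [apply/ffunP => j; rewrite !ffunE s0|rewrite /cZ s0]; rewrite min0n coord0.
Qed.

Lemma late_pos Q s : (len Q <= s)%N -> cU Q s = cUe Q.
Proof.
by move=> sl; apply/ffunP => i; rewrite !ffunE (minn_idPr sl) (minn_idPr _) //; lia.
Qed.

Lemma ends_bound_len Q : valid Q ->
  (forall j, `|cVe Q j| <= (len Q).+1%:Z) /\ `|cZe Q| <= (len Q).+1%:Z.
Proof.
move=> vQ; have [_ ev ec] := ends_bound vQ; split=> [j|]; last by lia.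
have : (absz (cVe Q j) <= absz (cVe Q j) ^ 2)%N.
  by case: (absz _) => // k; rewrite -mulnn leq_pmulr.
by have := ev j; lia.
Qed.

(* Left invariance reduces the third coordinate to [c' - c + omega (u' - u) v]:
   it stays bounded because [u' - u] is already constant during the second phase
   and [omega] is linear in [v], which moves along a straight line. *)
Lemma close_travel (R : realFieldType) C M : exists D, forall Q Q',
  valid Q -> valid Q' ->
  close C (cUe Q) (cVe Q) (cZe Q) (cUe Q') (cVe Q') (cZe Q') ->
  ((len Q).+1 <= M * (len Q').+1)%N -> ((len Q').+1 <= M * (len Q).+1)%N ->
  forall (s s' : nat) (th : R), 0 <= th <= 2 ->
  `|s%:R - th * (len Q).+1%:R| <= 2 -> `|s'%:R - th * (len Q').+1%:R| <= 2 ->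
  close D (cU Q s) (cV Q s) (cZ Q s) (cU Q' s') (cV Q' s') (cZ Q' s').
Proof.
(* [E] comes from [dist_scaled] and bounds the differences of u and of v. [B] comes from
   [small_scaled] and bounds v and c on one path while the other is still in its first phase. The
   term with factor 4 is the form applied to the deviation of v from its straight line. *)
pose B := (4 + 3 * M)%N; pose E := (C + 8)%N.
pose D := (E + B + N * E * B + N * C * 4)%N.
have [ED BD NBD NCD] : [/\ (E <= D)%N, (B <= D)%N, (B + N * E * B <= D)%N &
    (E + N * C * 4 <= D)%N] by rewrite /D; split; lia.
have BE : B%:R = 4 + 3 * M%:R :> R by rewrite natrD natrM.
have M0 : 0 <= M%:R :> R by [].
have small3 (x l : R) : `|0 - x * l| <= 3 -> x * l <= 3 by rewrite ler_norml; lra.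
have toR (x : int) (k : nat) : (`|x| <= k%:Z) = (`|x%:~R| <= k%:R :> R).
  by rewrite -intr_norm [in RHS]pmulrn ler_int.
have le_D k (x : int) : (k <= D)%N -> `|x| <= k%:Z -> `|x| <= D%:Z.
  by move=> kD xk; apply: le_trans xk _; rewrite lez_nat.
have N3 : N%:R * C%:R * 4 = (N * C * 4)%N%:R :> R by rewrite !natrM.
exists D => Q Q' vQ vQ' [bu bv bc] MQ MQ' s s' th th02 sE s'E.
have [t1 [t2 [t1E t2E T [HU HV HZ]]]] := pos_straight vQ th02 sE.
have [t1' [t2' [t1'E t2'E T' [HU' HV' HZ']]]] := pos_straight vQ' th02 s'E.
have e1 : t1' = t1 by rewrite t1'E t1E.
have e2 : t2' = t2 by rewrite t2'E t2E.
rewrite {}e1 {t1'E} in HU'; rewrite {}e2 {t2'E} in T' HV' HZ'.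
have [t101 t201] : 0 <= t1 <= 1 /\ 0 <= t2 <= 1.
  move: th02; rewrite t1E t2E => /andP[]; clear => ? ?.
  by split; [case: (lerP th 1)|case: (lerP (th - 1) 0)] => ?; apply/andP; split; lra.
have [t20 t21] := andP t201.
have dU i : `|(cU Q' s' - cU Q s) i| <= E%:Z.
  rewrite toR ffunB intrB natrD; apply: dist_scaled (HU i) (HU' i) _ => //.
  by rewrite -intrB -toR -ffunB.
have dV j : `|(cV Q' s' - cV Q s) j| <= E%:Z.
  rewrite toR ffunB intrB natrD; apply: dist_scaled (HV j) (HV' j) _ => //.
  by rewrite -intrB -toR -ffunB.
have rat' : (len Q').+1%:R <= M%:R * (len Q).+1%:R :> R by rewrite -natrM ler_nat.
have rat : (len Q).+1%:R <= M%:R * (len Q').+1%:R :> R by rewrite -natrM ler_nat.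
split=> [i|j|]; [exact: le_D (dU i)|exact: le_D (dV j)|].
have [sl|ls] := ltnP s (len Q).
  have [V0 Z0] := early_pos sl; rewrite V0 Z0 pairing0r subr0 addr0.
  apply: (le_D B) => //.
  have [_ cb] := ends_bound_len vQ'; rewrite toR in cb.
  rewrite toR BE; apply: small_scaled HZ' cb rat' _ => //; apply: small3.
  by move: T; rewrite (eqP (ltnW sl : s - len Q == 0)%N) min0n.
have [sl'|ls'] := ltnP s' (len Q').
  have [V0 Z0] := early_pos sl'; rewrite Z0 sub0r.
  have tl : t2 * (len Q').+1%:R <= 3.
    by apply: small3; move: T'; rewrite (eqP (ltnW sl' : s' - len Q' == 0)%N) min0n.
  have [vb cb] := ends_bound_len vQ; rewrite toR in cb.
  have ZB : `|cZ Q s| <= B%:Z by rewrite toR BE; apply: small_scaled HZ cb rat tl.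
  have VB j : `|cV Q s j| <= B%:Z.
    by rewrite toR BE; have := vb j; rewrite toR => vbj; apply: small_scaled (HV j) vbj rat tl.
  have ob := pairing_intbound dU VB; apply: (le_D (B + N * E * B)%N) => //.
  by move: (N * E * B)%N (omega _ _) (cZ Q s) ZB ob; clear => x y z; lia.
(* Both paths are in the second phase: the third coordinate of the quotient is compared with [t2]
   times its final value, which is at most [C]. The deviations of the two c-coordinates contribute
   8, that of v contributes [N * C * 4]. *)
rewrite (late_pos ls) (late_pos ls'); apply: (le_D (E + N * C * 4)%N) => //.
set d := cUe Q' - cUe Q.
have dC i : `|(d i)%:~R| <= C%:R :> R by rewrite -toR.
have := pairing_bound dC HV; rewrite N3.
have -> : \sum_i \sum_j (d i)%:~R * ((cV Q s j)%:~R - t2 * (cVe Q j)%:~R) * (pw i j)%:~R =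
   (omega d (cV Q s))%:~R - t2 * (omega d (cVe Q))%:~R :> R.
  rewrite !pairingE mulr_sumr -sumrB; apply: eq_bigr => i _.
  by rewrite mulr_sumr -sumrB; apply: eq_bigr => j _; clear; ring.
have : `|t2 * (cZe Q' - cZe Q + omega d (cVe Q))%:~R| <= C%:R.
  rewrite normrM ger0_norm //; move: bc; rewrite toR; apply: le_trans.
  exact: ler_piMl.
rewrite toR; move: HZ HZ'; rewrite /E !natrD !intrD !intrN !mulrDr mulrN.
move: (N * C * 4)%N%:R C%:R => x y.
move: (t2 * (cZe Q')%:~R) (t2 * (cZe Q)%:~R) (t2 * (omega d (cVe Q))%:~R).
move: (cZ Q' s')%:~R (cZ Q s)%:~R (omega d (cV Q s))%:~R => z1 z2 z3 z4 z5 z6.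
by clear; rewrite !ler_norml; lra.
Qed.

End Travel.

(** * The Cayley graph *)

Section Cayley.
Variables (R : realType) (G : groupType) (X : {fset G}).
Notation word := (word X).

Lemma path_ge0 (p q : cayley_point R X) r : path_of_length p q r -> 0 <= r.
Proof. by elim=> // *; rewrite addr_ge0. Qed.

Lemma cayley_dist_le (p q : cayley_point R X) r :
  path_of_length p q r -> cayley_dist p q <= r.
Proof.
move=> pq; apply: ge_inf => //; exists 0 => x; exact: path_ge0.
Qed.

Lemma path_cat (p q z : cayley_point R X) r r' :
  path_of_length p q r -> path_of_length q z r' -> path_of_length p z (r + r').
Proof.
move=> pq; elim: pq z r' => [p'|g x s t q' r0 s01 t01 _ IH] z r' qz; first by rewrite add0r.
by rewrite -addrA; apply: path_cons => //; exact: IH.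
Qed.

Lemma edge_point0 (g : G) (x : X) : edge_point g x 0 = Vertex R X g.
Proof. by rewrite /edge_point eqxx. Qed.

Lemma edge_point1 (g : G) (x : X) : edge_point g x 1 = Vertex R X (g * val x)%g.
Proof. by rewrite /edge_point oner_eq0 eqxx. Qed.

Lemma path_edge (g : G) (x : X) (s t : R) : 0 <= s <= 1 -> 0 <= t <= 1 ->
  path_of_length (edge_point g x s) (edge_point g x t) (`|s - t|).
Proof.
by move=> s01 t01; rewrite -[(`|_|)]addr0; apply: path_cons => //; exact: path_nil.
Qed.

Lemma path_word (g : G) (w : word) :
  path_of_length (Vertex R X g) (Vertex R X (g * word_val w)%g) (size w)%:R.
Proof.
elim: w g => [|x w IH] g; first by rewrite /word_val big_nil mulg1; exact: path_nil.
rewrite /word_val big_cons mulgA -/(word_val w).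
have -> : (size (x :: w))%:R = `|0 - 1| + (size w)%:R :> R.
  by rewrite sub0r normrN1 /= -natr1 addrC.
rewrite -(edge_point0 g x); apply: path_cons; rewrite ?lexx ?ler01 // edge_point1; exact: IH.
Qed.

(** The point lies on the edge leaving the last vertex passed. Both directions are recorded so that
    paths can be concatenated without being reversed. *)
Lemma word_path_near (w : word) (t : R) : 0 < t ->
  let g := Vertex R X (word_val (take (Num.truncn t) w)) in
  exists r r', [/\ r <= 1, r' <= 1, path_of_length (word_path w t) g r &
                path_of_length g (word_path w t) r'].
Proof.
move=> t0; rewrite /word_path (max_r (ltW t0)).
set i := Num.truncn t; have /andP[it ti] := truncn_itv (ltW t0).
have d01 : 0 <= t - i%:R <= 1.
  by rewrite subr_ge0 it lerBlDr addrC natr1 ltW.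
have z01 : 0 <= (0 : R) <= 1 by rewrite lexx ler01.
case dE: (drop i w) => [|x w'] /=.
  have -> : take i w = w.
    rewrite take_oversize //; have := congr1 size dE; rewrite size_drop /=; lia.
  by exists 0, 0; split; rewrite ?ler01 //; exact: path_nil.
rewrite -(edge_point0 _ x).
exists `|t - i%:R - 0|, `|0 - (t - i%:R)|; case/andP: (d01) => d0 d1.
have p1 := path_edge (word_val (take i w)) x d01 z01.
have p2 := path_edge (word_val (take i w)) x z01 d01.
by split=> //; rewrite ?subr0 ?sub0r ?normrN ger0_norm.
Qed.

Lemma cayley_dist_words (v w r : word) (s t : R) : 0 < s -> 0 < t ->
  (word_val (take (Num.truncn s) v) * word_val r =
   word_val (take (Num.truncn t) w))%g ->
  cayley_dist (word_path v s) (word_path w t) <= (size r)%:R + 2.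
Proof.
move=> s0 t0 E.
have [a [_ [a1 _ pa _]]] := word_path_near v s0.
have [_ [b [_ b1 _ pb]]] := word_path_near w t0.
have := path_word (word_val (take (Num.truncn s) v)) r; rewrite E => pr.
apply: le_trans (cayley_dist_le (path_cat pa (path_cat pr pb))) _; lra.
Qed.

Section Linear.
Variables (v w : word).
Let a : R := (size v)%:R + 1.
Let b : R := (size w)%:R + 1.
Let a0 : 0 < a. Proof. by rewrite ltr_wpDl. Qed.
Let b0 : 0 < b. Proof. by rewrite ltr_wpDl. Qed.
Let h (t : R) : R := b / a * t.

(** Constant relative speed suffices: the linear [h] of slope [b / a] maps the first interval onto
    the second, and the bounds on its derivative are bounds on the ratio of the lengths. *)
Lemma linear_fellow_travel (K M : R) :
  1 / M <= b / a <= M ->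
  (forall t, 0 < t -> cayley_dist (word_path v t) (word_path w (h t)) <= K) ->
  bounded_async_fellow_travel K M v w.
Proof.
move=> ab HK; have q0 : 0 < b / a by rewrite divr_gt0.
have hE (t : R) : is_derive t 1 h (b / a).
  apply: is_derive_eq (is_deriveZ (b / a) (is_derive_id t (1 : R))) _.
  exact: mulr1.
exists h; last by move=> t; rewrite derive1E; have [_ ->] := hE t.
split=> //.
- apply/seteqP; split=> [_ [t /= tI <-]|u /= uI].
    move: tI; rewrite !in_itv /= => /andP[t0 ta]; apply/andP; split.
      by rewrite mulr_ge0 // ltW.
    by rewrite /h mulrAC ler_pdivrMr // ler_pM2l.
  exists (a / b * u); last by rewrite /h; field; rewrite !lt0r_neq0.
  move: uI; rewrite /= !in_itv /= => /andP[u0 ub]; apply/andP; split.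
    by rewrite mulr_ge0 // divr_ge0 // ltW.
  by rewrite mulrAC ler_pdivrMr // ler_pM2l.
- by move=> s t _ _ st; rewrite /h ltr_pM2l.
Qed.

End Linear.

End Cayley.

(** * Fellow travelling *)

Section CombingTheorem.
Variables (G : groupType) (P : polarization G) (g0 : G).

Notation letters := (letters P g0).
Notation lang := (@lang G P g0).
Notation spell := (@spell G P g0).
Notation k := (code_len P).
Notation zok := (zok P).
Notation omega := (pairing (pw (p:=P))).
Notation param := (param P).
Implicit Types (Q : param) (C : nat).
Notation cUe Q := (cU Q (2 * len Q)).
Notation cVe Q := (cV Q (2 * len Q)).
Notation cZe Q := (cZ Q (2 * len Q)).
Notation N := (pairing_norm P).
Notation endpoint Q := (point (cUe Q) (cVe Q) (cZe Q)).

Definition short C (g : G) : Prop :=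
  exists2 r : word letters, (size r <= C)%N & word_val r = g.

Lemma shortM C C' g g' : short C g -> short C' g' -> short (C + C') (g * g')%g.
Proof.
move=> [r rC <-] [r' rC' <-]; exists (r ++ r'); last exact: word_val_cat.
by rewrite size_cat leq_add.
Qed.

Lemma short_letter g : g \in letters -> short 1 g.
Proof.
by move=> gX; exists [:: to_letter P g0 g]; rewrite // /word_val big_seq1 to_letterK.
Qed.

Lemma shortV C g : short C g -> short C g^-1%g.
Proof.
move=> [r rC <-]; exists (rev (map (fun x : letters => to_letter P g0 (val x)^-1%g) r)).
  by rewrite size_rev size_map.
elim: r {rC} => [|x r IH]; first by rewrite /word_val !big_nil invg1.
rewrite map_cons rev_cons -cats1 word_val_cat IH /word_val big_seq1 big_cons invgM.
by rewrite to_letterK //; exact: letters_inv (valP x).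
Qed.

Definition near (g g' : G) : Prop := (g^-1 * g')%g \in letters.

Lemma near_sym g g' : near g g' -> near g' g.
Proof. by move=> /letters_inv; rewrite /near invgM invgK. Qed.

Lemma cZ_ok Q : valid Q -> zok || (cZe Q == 0).
Proof.
move=> [_ _ [_ /orP[->//|lp]] _]; apply/orP; right.
by rewrite cZeE /coord divn_small // mulr0.
Qed.

Lemma div_ok (u : {ffun 'I_(pn P) -> int}) (v : {ffun 'I_(pm P) -> int}) c u' c' :
  zok || (c == 0) -> zok || (c' == 0) ->
  zok || (c' - c + omega (u' - u) v == 0).
Proof.
case: (boolP zok) => //= nz /eqP -> /eqP ->.
rewrite subrr add0r /pairing big1 // => i _; rewrite big1 // => j _.
by rewrite (pw0 nz) mulr0.
Qed.

Lemma word_val_param Q : valid Q ->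
  word_val (spell (param_word Q)) = (endpoint Q * val (rep Q))%g.
Proof.
move=> vQ; rewrite word_val_spell -[param_word Q]take_size size_param_word param_word_val //.
rewrite ifN; last by rewrite -ltnNge.
congr (point _ _ _ * _)%g.
- by apply/ffunP => i; rewrite !ffunE !(minn_idPr _) //; lia.
- by apply/ffunP => i; rewrite !ffunE !(minn_idPr _) //; lia.
- by rewrite /cZ !(minn_idPr _) //; lia.
Qed.

(** The quotient of the two points has the form [t * x / t'] with [x] a letter and [t], [t']
    representatives, so it ranges over a finite set. *)
Lemma near_close : exists C, forall (u : {ffun 'I_(pn P) -> int})
    (v : {ffun 'I_(pm P) -> int}) c u' v' c' t t',
  zok || (c == 0) -> zok || (c' == 0) -> t \in reps P -> t' \in reps P ->
  near (point u v c * t)%g (point u' v' c' * t')%g -> close C u v c u' v' c'.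
Proof.
pose F := [seq (tx.1 * tx.2 / t')%g | tx <- [seq (t, x) | t <- reps P, x <- enum_fset letters],
                                      t' <- reps P].
have [C HC] := bounded_finite P F; exists C => u v c u' v' c' t t' cok c'ok tT t'T nr.
apply: HC; first exact: div_ok.
rewrite -point_div; apply/allpairsP.
exists ((t, ((point u v c * t)^-1 * (point u' v' c' * t'))%g), t'); split => //=.
  by apply/allpairsP; exists (t, ((point u v c * t)^-1 * (point u' v' c' * t'))%g); split.
by rewrite (invgM (point u v c) t) !mulgA mulgV mul1g mulgK.
Qed.

Lemma take_param Q i : valid Q ->
  let s := (i %/ k)%N in
  short (k + 1) ((point (cU Q s) (cV Q s) (cZ Q s))^-1 *
                 word_val (take i (spell (param_word Q))))%g.
Proof.
move=> vQ s; have [r rk ->] := take_spell g0 (param_word Q) i.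
rewrite param_word_val // mulgA mulKg addnC; apply: shortM; last by exists r.
case: ifP => _; apply: short_letter; first exact: mem_letters1.
exact/mem_letters_rep/valP.
Qed.

Section Real.
Variable R : realType.

(** Since [d * (2 * l).+1 + 1 = 2 * d * l.+1 - (d - 1)], time [t] differs from [th * l.+1] blocks of
    [d] letters by less than one block; rounding down to whole blocks loses at most one more. *)
Lemma sync_index (d l : nat) (th t : R) : (0 < d)%N -> 0 <= th <= 2 ->
  2 * t = th * ((d * (2 * l).+1)%N%:R + 1) ->
  `|(Num.truncn t %/ d)%:R - th * l.+1%:R| <= 2.
Proof.
move=> d0 /andP[th0 th2].
have -> : (d * (2 * l).+1)%N%:R + 1 = d%:R * (2 * l%:R + 1) + 1 :> R.
  by rewrite natrM -natr1 natrM.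
have -> : l.+1%:R = l%:R + 1 :> R by rewrite natr1.
move=> tE.
have d1 : 1 <= d%:R :> R by rewrite ler1n.
have t0 : 0 <= t.
  by rewrite -(pmulr_rge0 _ (ltr0Sn R 1)) tE mulr_ge0.
have /andP[it ti] := truncn_itv t0; move: it ti; set i := Num.truncn t.
rewrite -natr1 => it ti.
have di : (d * (i %/ d) <= i)%N /\ (i.+1 <= d * (i %/ d) + d)%N.
  by have := divn_eq i d; have := ltn_pmod i d0; clear; lia.
have [k1 k2] : d%:R * (i %/ d)%:R <= i%:R :> R /\ i%:R + 1 <= d%:R * (i %/ d)%:R + d%:R :> R.
  by case: di => ? ?; split; [rewrite -natrM ler_nat|rewrite natr1 -natrM -natrD ler_nat].
move: (i %/ d)%:R l%:R i%:R d%:R tE d1 k1 k2 it ti => s y x k tE d1 k1 k2 it ti.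
have kpos : 0 < k by lra.
have e1 : k * (th * (y + 1)) = t + th * (k - 1) / 2.
  have -> : t = th * (k * (2 * y + 1) + 1) / 2 by rewrite -tE; field.
  by field.
have e2 : 0 <= th * (k - 1) <= 2 * (k - 1).
  by apply/andP; split; [apply: mulr_ge0|apply: ler_wpM2r]; lra.
have f1 : k * s <= k * (th * (y + 1)) by rewrite e1; lra.
have f2 : k * (th * (y + 1)) <= k * (s + 2) by rewrite e1; lra.
rewrite ler_pM2l // in f1; rewrite ler_pM2l // in f2.
by rewrite ler_norml; lra.
Qed.

Lemma lang_fellow_travel : exists K M : nat, (0 < M)%N /\
  forall v w, combing_pair lang v w ->
    bounded_async_fellow_travel (K%:R : R) M%:R v w.
Proof.
have [C HC] := near_close.
have [M HM] := len_ratio P C.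
have [D HD] := @close_travel _ P R C M.
(* [3 * D] spells the quotient of the two points, each [k + 1] an incomplete block and the closing
   letter, and the final 2 two partial edges. The slope bound doubles [M] because [k * (2 * a).+1]
   is compared with [2 * (k * a.+1)]. *)
exists (((k + 1) + 3 * D + (k + 1)).+1 + 2)%N, (2 * M).+1; split=> //.
move=> v w [/lang_param[Q vQ vE] /lang_param[Q' vQ' wE] vw].
have nr : near (word_val v) (word_val w).
  rewrite /near; case: vw => [->|[x ->]]; first by rewrite mulVg mem_letters1.
  by rewrite mulKg; exact: valP.
have cl : close C (cUe Q) (cVe Q) (cZe Q) (cUe Q') (cVe Q') (cZe Q').
  apply: (HC _ _ _ _ _ _ (val (rep Q)) (val (rep Q'))); rewrite ?cZ_ok //; try exact: valP.
  by rewrite -!word_val_param // -vE -wE.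
have cl' : close C (cUe Q') (cVe Q') (cZe Q') (cUe Q) (cVe Q) (cZe Q).
  apply: (HC _ _ _ _ _ _ (val (rep Q')) (val (rep Q))); rewrite ?cZ_ok //; try exact: valP.
  by rewrite -!word_val_param // -vE -wE; apply: near_sym.
have MQ := HM _ _ vQ vQ' cl; have MQ' := HM _ _ vQ' vQ cl'.
have sv : size v = (k * (2 * len Q).+1)%N by rewrite vE size_spell size_param_word.
have sw : size w = (k * (2 * len Q').+1)%N by rewrite wE size_spell size_param_word.
have rat (a b : nat) : (a.+1 <= M * b.+1)%N ->
    (k * (2 * a).+1)%N%:R + 1 <= (2 * M).+1%:R * ((k * (2 * b).+1)%N%:R + 1) :> R.
  move=> ab; rewrite !natr1 -natrM ler_nat.
  have h1 : (k * (2 * a).+1 < 2 * (k * a.+1))%N by rewrite /code_len; lia.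
  have h2 : (2 * (k * a.+1) <= 2 * (k * (M * b.+1)))%N by rewrite !leq_mul2l ab !orbT.
  have h3 : (2 * (k * (M * b.+1)) = (2 * M) * (k * b.+1))%N by lia.
  have h4 : ((2 * M) * (k * b.+1) <= (2 * M) * (k * (2 * b).+1).+1)%N.
    by rewrite leq_mul2l; apply/orP; right; lia.
  by rewrite mulSn; lia.
set a : R := (size v)%:R + 1; set b : R := (size w)%:R + 1.
have a0 : 0 < a by rewrite ltr_wpDl.
have b0 : 0 < b by rewrite ltr_wpDl.
have q0 : 0 < b / a by rewrite divr_gt0.
apply: linear_fellow_travel; rewrite -/a -/b.
  rewrite ler_pdivrMr ?ltr0n // ler_pdivrMr // mulrAC ler_pdivlMr // mul1r.
  apply/andP; split; last by rewrite /a /b sv sw rat.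
  by rewrite mulrC /a /b sv sw rat.
move=> t t0.
have ht0 : 0 < b / a * t by rewrite mulr_gt0.
have [r rK rE] : short ((k + 1) + 3 * D + (k + 1)).+1
    ((word_val (take (Num.truncn t) v))^-1 * word_val (take (Num.truncn (b / a * t)) w))%g.
  have [ta|at_] := lerP t a; last first.
    rewrite !take_oversize.
    - have [r r1 rE] := short_letter nr; exists r => //; lia.
    - rewrite truncn_ge_nat ?(ltW ht0) //; apply: (@le_trans _ _ b); first by rewrite lerDl.
      by rewrite mulrAC ler_pdivlMr // ler_pM2l // ltW.
    - rewrite truncn_ge_nat ?(ltW t0) //; apply: (@le_trans _ _ a); last exact: ltW.
      by rewrite lerDl.
  (* With proportional speeds [t / a] equals [(b / a * t) / b], so both words are at the same
     normalized time. *)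
  pose th : R := 2 * t / a.
  have th02 : 0 <= th <= 2.
    rewrite /th divr_ge0 ?mulr_ge0 ?(ltW t0) ?(ltW a0) //=.
    by rewrite ler_pdivrMr // ler_pM2l.
  have sE : `|(Num.truncn t %/ k)%:R - th * (len Q).+1%:R| <= 2.
    by apply: sync_index => //; rewrite -sv -/a /th divfK // lt0r_neq0.
  have s'E : `|(Num.truncn (b / a * t) %/ k)%:R - th * (len Q').+1%:R| <= 2.
    apply: sync_index => //; rewrite -sw -/b /th.
    by move: (lt0r_neq0 a0) => ?; field.
  have cl2 := HD _ _ vQ vQ' cl MQ MQ' _ _ _ th02 sE s'E.
  have sh1 := take_param (Num.truncn t) vQ.
  have sh3 := take_param (Num.truncn (b / a * t)) vQ'.
  have [r2 r2D r2E] := bounded_word g0 cl2.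
  have sh2 : short (3 * D) ((point (cU Q (Num.truncn t %/ k)) (cV Q (Num.truncn t %/ k))
      (cZ Q (Num.truncn t %/ k)))^-1 *
    point (cU Q' (Num.truncn (b / a * t) %/ k)) (cV Q' (Num.truncn (b / a * t) %/ k))
      (cZ Q' (Num.truncn (b / a * t) %/ k)))%g by rewrite point_div; exists r2.
  have [r rK] := shortM (shortM (shortV sh1) sh2) sh3.
  have cancel (p x p' y : G) : ((p^-1 * x)^-1 * (p^-1 * p') * (p'^-1 * y) = x^-1 * y)%g.
    by rewrite invgM invgK !mulgA !mulgK.
  rewrite cancel -vE -wE => rE.
  by exists r => //; apply: leq_trans rK _; lia.
have := @cayley_dist_words R _ _ v w r t (b / a * t) t0 ht0.
rewrite rE mulVKg => /(_ erefl) H; apply: le_trans H _.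
by rewrite natrD lerD2r ler_nat.
Qed.

Lemma lang_reps (g : G) : exists2 w, lang w & word_val w = g.
Proof.
have [u [v [c [t [cok tT ->]]]]] := coords_gen P g.
have [Q [vQ Ql rE [uE vE cE]]] := exists_param g0 u v (SeqSub tT) cok.
exists (spell (param_word Q)) => //.
by rewrite word_val_param // uE vE cE rE.
Qed.

Lemma lang_bounded_async : bounded_async_combing R lang.
Proof.
split; first exact: lang_reps.
have [K [M [M0 H]]] := lang_fellow_travel; exists K%:R, M%:R; split=> //.
by rewrite ltr0n.
Qed.

Lemma lang_async : async_combing R lang.
Proof.
have [H [K [M [_ KM]]]] := lang_bounded_async; split=> //; exists K => v w /KM[h hh _].
by exists h.
Qed.

End Real.

Lemma lang_generates : generates letters.
Proof.
apply/seteqP; split=> // g _; rewrite /generated /smallest /= => H [[H1 HD] HX].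
have [w _ <-] := lang_reps g.
rewrite /word_val; elim: w => [|x w IH]; first by rewrite big_nil; apply: set_mem H1.
rewrite big_cons; apply: set_mem.
have HM : mulg_closed (mem H) by apply: group_closedM.
by apply: HM; [apply: mem_set; apply: HX => /=; exact: valP|exact: mem_set].
Qed.

End CombingTheorem.

(** * Length *)

Section Length.
Variables (G : groupType) (P : polarization G) (g0 : G).

Notation letters := (letters P g0).
Notation lang := (@lang G P g0).
Notation zok := (zok P).
Notation omega := (pairing (pw (p:=P))).
Notation param := (param P).
Implicit Types (Q : param) (C : nat).
Notation cUe Q := (cU Q (2 * len Q)).
Notation cVe Q := (cV Q (2 * len Q)).
Notation cZe Q := (cZ Q (2 * len Q)).
Notation N := (pairing_norm P).

(** Appending a letter changes u and v by at most a constant, so they grow linearly; c changes by a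
    constant plus a shear bounded by a multiple of |v|, so it grows quadratically. *)
Lemma word_coords : exists C, forall (r : word letters)
    (u : {ffun 'I_(pn P) -> int}) (v : {ffun 'I_(pm P) -> int}) c t,
  zok || (c == 0) -> t \in reps P -> word_val r = (point u v c * t)%g ->
  let X := (C * (size r).+1)%N in
  [/\ forall i, `|u i| <= X%:Z, forall j, `|v j| <= X%:Z &
      `|c| <= (X + N * X ^ 2)%N%:Z].
Proof.
have [C HC] := near_close P g0.
have [C' HC'] := bounded_finite P [seq t^-1%g | t <- reps P].
exists (maxn C C'); elim/last_ind => [|r x IH] u v c t cok tT rE X.
  have [bu bv bc] : bounded C' u v c.
    apply: HC' => //; apply/seq.mapP; exists t => //.
    by apply: (mulIg t); rewrite -rE mulVg /word_val big_nil.
  have CX : C'%:Z <= X%:Z by rewrite lez_nat /X /= muln1 leq_maxr.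
  split=> [i|j|]; [exact: le_trans (bu i) CX|exact: le_trans (bv j) CX|].
  by apply: le_trans bc _; rewrite lez_nat (leq_trans _ (leq_addr _ _)).
have [u' [v' [c' [t' [c'ok t'T E]]]]] := coords_gen P (word_val r).
have [bu bv bc] := IH _ _ _ _ c'ok t'T E.
have [du dv dc] : close C u' v' c' u v c.
  apply: (HC _ _ _ _ _ _ t' t) => //; rewrite /near -rE -E -cats1 word_val_cat mulKg.
  by rewrite /word_val big_seq1; exact: valP.
have ob := pairing_intbound du bv.
set Y := (maxn C C' * (size r).+1)%N in bu bv bc ob *.
have XE : X = (Y + maxn C C')%N by rewrite /X size_rcons mulnS addnC.
have CM : (C <= maxn C C')%N by exact: leq_maxl.
move: (maxn C C') CM XE => K CK XE.
split=> [i|j|].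
- by have := bu i; have := du i; rewrite ffunB; move: (u i) (u' i); clear -XE CK; lia.
- by have := bv j; have := dv j; rewrite ffunB; move: (v j) (v' j); clear -XE CK; lia.
(* The cross term of [(Y + K) ^ 2] absorbs the shear caused by the new letter. *)
have h : (N * C * Y + N * Y ^ 2 <= N * X ^ 2)%N.
  rewrite -mulnA -mulnDr leq_mul2l; apply/orP; right; rewrite XE sqrnD.
  have : (C * Y <= K * Y)%N by rewrite leq_mul2r CK orbT.
  by rewrite (mulnC K); move: (C * Y)%N (Y * K)%N (K ^ 2)%N (Y ^ 2)%N; clear; lia.
move: dc ob bc h; move: (N * C * Y)%N (N * Y ^ 2)%N (N * X ^ 2)%N (omega _ _).
by clear -XE CK; lia.
Qed.

Lemma quadratic_size : exists A : nat, (0 < A)%N /\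
  forall w : word letters, lang w -> (size w <= A * (geodesic_length w).+1 ^ 2)%N.
Proof.
have [C HC] := word_coords.
exists (code_len P * (6 * (2 * C.+1 ^ 2 + (C + N * C ^ 2) + 2)))%N; split.
  by rewrite !muln_gt0 /= addn_gt0 orbT.
move=> w /lang_param[Q vQ wE].
rewrite /geodesic_length; case: ex_minnP => l /asboolP[r rw rl] _.
have rE : word_val r = (point (cUe Q) (cVe Q) (cZe Q) * val (rep Q))%g.
  by rewrite rw wE word_val_param.
have [bu bv bc] := HC r _ _ _ _ (cZ_ok vQ) (valP (rep Q)) rE.
have := len_upper vQ bu bv bc; rewrite rl wE size_spell size_param_word.
move=> lQ; rewrite -mulnA leq_mul2l; apply/orP; right.
have h1 : (2 * (C * l.+1).+1 ^ 2 <= 2 * C.+1 ^ 2 * l.+1 ^ 2)%N.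
  by rewrite -mulnA leq_mul2l -expnMn leq_exp2r //= mulSn; lia.
have h2 : (C * l.+1 <= C * l.+1 ^ 2)%N by rewrite leq_mul2l -mulnn leq_pmulr ?orbT.
have h3 : (N * (C * l.+1) ^ 2 = N * C ^ 2 * l.+1 ^ 2)%N by rewrite expnMn mulnA.
have h4 : (1 <= l.+1 ^ 2)%N by rewrite expn_gt0.
have -> : (6 * (2 * C.+1 ^ 2 + (C + N * C ^ 2) + 2) * l.+1 ^ 2 =
   6 * (2 * C.+1 ^ 2 * l.+1 ^ 2 + C * l.+1 ^ 2 + N * C ^ 2 * l.+1 ^ 2 + 2 * l.+1 ^ 2))%N.
  by rewrite -mulnA !mulnDl addnA.
rewrite -h3; move: lQ h1 h2 h4; move: (C.+1 ^ 2)%N (l.+1 ^ 2)%N (N * _ ^ 2)%N (_.+1 ^ 2)%N.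
move: (len Q) (C * l.+1)%N => q x a L b d; move: (2 * a * L)%N (C * L)%N; clear; lia.
Qed.

Lemma lang_quadratic (R : realType) : at_most_quadratic_length R lang.
Proof.
have [A [A0 HA]] := quadratic_size.
have Hf n : exists fn,
    (exists w, [/\ lang w, (geodesic_length w <= n)%N & size w = fn]) /\
    (forall w, lang w -> (geodesic_length w <= n)%N -> (size w <= fn)%N).
  pose S k := `[< exists w, [/\ lang w, (geodesic_length w <= n)%N & size w = k] >].
  have exS : exists k, S k.
    have [w Lw w1] := lang_reps P g0 1%g.
    exists (size w); apply/asboolP; exists w; split=> //.
    rewrite /geodesic_length; case: ex_minnP => l _ lmin.
    apply: leq_trans (lmin 0%N _) _ => //; apply/asboolP.
    by exists [::]; rewrite // w1 /word_val big_nil.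
  have bS k : S k -> (k <= A * n.+1 ^ 2)%N.
    move=> /asboolP[w [Lw wn <-]]; apply: leq_trans (HA w Lw) _.
    by rewrite leq_mul2l leq_exp2r ?ltnS ?wn ?orbT.
  case: (ex_maxnP exS bS) => k /asboolP[w [Lw wn wk]] kmax.
  exists k; split; first by exists w.
  by move=> w' Lw' wn'; apply: kmax; apply/asboolP; exists w'.
have [f fP] := choice Hf; exists f; first exact: fP.
exists (A%:R *: ('X - (-1)%:P) ^+ 2).
  rewrite size_scale ?pnatr_eq0 ?lt0n_neq0 //.
  by rewrite size_exp_XsubC.
move=> n; have [[w [Lw wn <-]] _] := fP n.
rewrite hornerZ horner_exp hornerXsubC opprK natr1 -natrX -natrM ler_nat.
apply: leq_trans (HA w Lw) _.
by rewrite leq_mul2l leq_exp2r ?ltnS ?wn ?orbT.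
Qed.

End Length.

Theorem polarization_combing (R : realType) (G : groupType) (P : polarization G) (g0 : G) :
  g0 != 1%g ->
  exists (X : {fset G}) (L : set (word X)),
    [/\ inverse_closed X, generates X, real_time_combing R L,
        bounded_async_combing R L & at_most_quadratic_length R L].
Proof.
move=> g01; exists (letters P g0), (@lang G P g0); split.
- exact: letters_inv.
- exact: lang_generates.
- by split; [exact: lang_async|exact: real_time_lang].
- exact: lang_bounded_async.
- exact: lang_quadratic.
Qed.

(** * Existence of polarizations *)

Section IntPowers.
Variable G : groupType.
Implicit Types (x y : G) (a b : int).

Definition expgz x a : G := match a with Posz k => (x ^+ k)%g | Negz k => (x ^- k.+1)%g end.

Lemma expgz0 x : expgz x 0 = 1%g. Proof. by []. Qed.
Lemma expgz1 x : expgz x 1 = x. Proof. by []. Qed.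

Lemma expgzS x a : expgz x (a + 1) = (expgz x a * x)%g.
Proof.
case: a => k; first by rewrite -PoszD addn1 /= expgSr.
case: k => [|k]; first by rewrite /= mulVg.
have -> : Negz k.+1 + 1 = Negz k by lia.
by rewrite /= [(x ^+ k.+2)%g]expgS invgM mulgVK.
Qed.

Lemma expgzDn x a (k : nat) : expgz x (a + k%:Z) = (expgz x a * x ^+ k)%g.
Proof.
elim: k => [|k IH]; first by rewrite addr0 mulg1.
by rewrite -addn1 PoszD addrA expgzS IH -mulgA -expgSr addn1.
Qed.

Lemma expgzD x a b : expgz x (a + b) = (expgz x a * expgz x b)%g.
Proof.
case: b => k; first exact: expgzDn.
rewrite -[in RHS](subrK (k.+1)%:Z a) expgzDn /= mulgK NegzE.
by congr expgz.
Qed.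

Lemma expgzN x a : expgz x (- a) = (expgz x a)^-1%g.
Proof. by apply: (@mulgI _ (expgz x a)); rewrite -expgzD subrr mulgV. Qed.

Lemma expgzM x a b : expgz x (a * b) = expgz (expgz x a) b.
Proof.
have n k : expgz x (a * k%:Z) = expgz (expgz x a) k%:Z.
  elim: k => [|k IH]; first by rewrite mulr0.
  by rewrite -addn1 PoszD mulrDr mulr1 !expgzD IH.
case: b => k; first exact: n.
by rewrite NegzE mulrN !expgzN n.
Qed.

Lemma expgz_nat x (k : nat) : expgz x k%:Z = (x ^+ k)%g. Proof. by []. Qed.

Lemma commute_expgz x y a : commute x y -> commute x (expgz y a).
Proof. by case: a => k xy /=; [|apply: commuteV]; apply: commuteX. Qed.

Lemma expgzMl x y a : commute x y -> expgz (x * y)%g a = (expgz x a * expgz y a)%g.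
Proof.
move=> xy; case: a => k /=; first by rewrite expgMn.
rewrite expgMn // invgM; apply: commute_sym.
by apply: commuteV; apply: commute_sym; apply: commuteV; apply: commuteX2.
Qed.

Lemma conj_expgz x y a : (expgz x a ^ y)%g = expgz (x ^ y)%g a.
Proof. by case: a => k /=; rewrite ?conjVg conjXg. Qed.

(** Exponents form a function on all of [nat], so that passing to the tail is a shift; values beyond
    the length of [s] are ignored. *)
Fixpoint lprod (s : seq G) (e : nat -> int) : G :=
  if s is x :: s' then (expgz x (e 0%N) * lprod s' (fun i => e i.+1))%g else 1%g.

Lemma eq_lprod s e f : (forall i, (i < size s)%N -> e i = f i) -> lprod s e = lprod s f.
Proof.
elim: s e f => //= x s IH e f ef; rewrite (ef 0%N) //; congr (_ * _)%g.
by apply: IH => i si; apply: ef.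
Qed.

Lemma lprod0 s e : (forall i, e i = 0) -> lprod s e = 1%g.
Proof. by elim: s e => //= x s IH e e0; rewrite e0 mul1g IH. Qed.

Lemma commute_lprod x s e : {in s, forall y, commute x y} -> commute x (lprod s e).
Proof.
elim: s e => /= [|y s IH] e xs; first exact: commute1.
apply: commuteM; first by apply/commute_expgz/xs; rewrite inE eqxx.
by apply: IH => z zs; apply: xs; rewrite inE zs orbT.
Qed.

Lemma lprodD s e f : {in s &, forall x y, commute x y} ->
  lprod s (fun i => e i + f i) = (lprod s e * lprod s f)%g.
Proof.
elim: s e f => [|x s IH] e f C /=; first by rewrite mulg1.
rewrite expgzD IH; last by move=> y z ys zs; apply: C; rewrite inE ?ys ?zs orbT.
rewrite -!mulgA; congr (_ * _)%g; rewrite !mulgA; congr (_ * _)%g.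
apply: commute_lprod => y ys; apply/commute_sym/commute_expgz/C; rewrite inE ?ys ?eqxx ?orbT //.
Qed.

Lemma lprodZ s e a : {in s &, forall x y, commute x y} ->
  lprod s (fun i => e i * a) = expgz (lprod s e) a.
Proof.
elim: s e => [|x s IH] e C /=.
  by case: a => k /=; rewrite ?expg1n ?invg1.
rewrite expgzM IH; last by move=> y z ys zs; apply: C; rewrite inE ?ys ?zs orbT.
rewrite expgzMl //; apply: commute_lprod => y ys; apply/commute_sym/commute_expgz/C;
  by rewrite inE ?ys ?eqxx ?orbT.
Qed.

Definition econs a (e : nat -> int) (i : nat) : int := if i is j.+1 then e j else a.

Lemma lprod_cons x s a e : lprod (x :: s) (econs a e) = (expgz x a * lprod s e)%g.
Proof. by []. Qed.

End IntPowers.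

(** * Calculus modulo a central element that generates all commutators *)

Section CyclicCommutators.
Variables (G : groupType) (z : G).
Hypothesis z_central : forall g, commute z g.
Hypothesis comz : forall x y : G, exists a, (x * y = y * x * expgz z a)%g.
Implicit Types (x y g h : G) (a b c : int) (s : seq G).

Lemma expgz_central c g : commute (expgz z c) g.
Proof. exact/commute_sym/commute_expgz/commute_sym. Qed.

(** Equality in the abelian quotient by the subgroup generated by [z], handled as a congruence
    instead of forming the quotient. *)
Definition eqmod x y := exists c, x = (y * expgz z c)%g.

Lemma eqmod_refl x : eqmod x x. Proof. by exists 0; rewrite mulg1. Qed.

Lemma eqmod_sym x y : eqmod x y -> eqmod y x.
Proof. by move=> [c ->]; exists (- c); rewrite expgzN mulgK. Qed.

Lemma eqmod_trans x y g : eqmod x y -> eqmod y g -> eqmod x g.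
Proof. by move=> [c ->] [d ->]; exists (d + c); rewrite expgzD mulgA. Qed.

Lemma eqmodM x y g h : eqmod x y -> eqmod g h -> eqmod (x * g)%g (y * h)%g.
Proof.
move=> [c ->] [d ->]; exists (c + d); rewrite expgzD -!mulgA; congr (_ * _)%g.
by rewrite !mulgA; congr (_ * _)%g; exact: expgz_central.
Qed.

Lemma eqmodC x y : eqmod (x * y)%g (y * x)%g. Proof. exact: comz. Qed.

Lemma eqmodV x y : eqmod x y -> eqmod x^-1%g y^-1%g.
Proof.
move=> [c ->]; exists (- c); rewrite invgM -expgzN; exact: expgz_central.
Qed.

Lemma eqmod_expgzMl x y a : eqmod (expgz (x * y)%g a) (expgz x a * expgz y a)%g.
Proof.
have nat_case k : eqmod (expgz (x * y)%g k%:Z) (expgz x k%:Z * expgz y k%:Z)%g.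
  elim: k => [|k IH]; first by rewrite !expgz0 mulg1; exact: eqmod_refl.
  rewrite -addn1 PoszD !expgzS.
  apply: eqmod_trans (eqmodM IH (eqmod_refl (x * y)%g)) _.
  rewrite -!mulgA; apply: eqmodM (eqmod_refl _) _; rewrite !mulgA.
  by apply: eqmodM (eqmod_refl _); exact: eqmodC.
case: a => k; first exact: nat_case.
rewrite NegzE !expgzN; apply: eqmod_trans (eqmodV (nat_case _)) _; rewrite invgM; exact: eqmodC.
Qed.

Lemma eqmod_expgz x y a : eqmod x y -> eqmod (expgz x a) (expgz y a).
Proof.
by move=> [c ->]; exists (c * a); rewrite expgzMl ?expgzM //; exact/commute_sym/expgz_central.
Qed.

Lemma eqmod_perm x y g h : eqmod (x * y * (g * h))%g (x * g * (y * h))%g.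
Proof.
rewrite -!mulgA; apply: eqmodM (eqmod_refl _) _; rewrite !mulgA.
by apply: eqmodM (eqmod_refl _); exact: eqmodC.
Qed.

Lemma eqmod_lprodD s e f : eqmod (lprod s (fun i => e i + f i)) (lprod s e * lprod s f)%g.
Proof.
elim: s e f => [|x s IH] e f /=; first by rewrite mulg1; exact: eqmod_refl.
rewrite expgzD; apply: eqmod_trans (eqmodM (eqmod_refl _) (IH _ _)) _; exact: eqmod_perm.
Qed.

Lemma eqmod_lprodZ s e a : eqmod (lprod s (fun i => e i * a)) (expgz (lprod s e) a).
Proof.
elim: s e => [|x s IH] e /=.
  by case: a => k /=; rewrite ?expg1n ?invg1; exact: eqmod_refl.
rewrite expgzM; apply: eqmod_trans (eqmodM (eqmod_refl _) (IH _)) _.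
by apply: eqmod_sym; exact: eqmod_expgzMl.
Qed.

Lemma eqmod_lprodN s e : eqmod (lprod s (fun i => - e i)) (lprod s e)^-1%g.
Proof.
have := eqmod_lprodZ s e (- 1); rewrite expgzN expgz1; apply: eqmod_trans.
by rewrite (@eq_lprod _ s _ (fun i => e i * -1)); [exact: eqmod_refl|move=> i _; rewrite mulrN1].
Qed.

(** This and the next lemmas are the bilinearity of the commutator. The exponent of [z] is kept as a
    relation, since it is not unique when [z] has finite order. *)
Lemma swap_expgzl x y a c : (x * y = y * x * expgz z c)%g ->
  (expgz x a * y = y * expgz x a * expgz z (a * c))%g.
Proof.
move=> xy; rewrite conjgC conj_expgz.
have -> : (x ^ y = x * expgz z c)%g by rewrite /conjg xy -mulgA mulKg.
by rewrite expgzMl ?(mulrC a) ?expgzM ?mulgA //; exact/commute_sym/expgz_central.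
Qed.

Lemma swap_sym x y c : (x * y = y * x * expgz z c)%g -> (y * x = x * y * expgz z (- c))%g.
Proof. by move=> ->; rewrite expgzN mulgK. Qed.

Lemma swap_comm x y : commute x y -> (x * y = y * x * expgz z 0)%g.
Proof. by move=> xy; rewrite mulg1. Qed.

Lemma swap_mul x x' y c c' :
  (x * y = y * x * expgz z c)%g -> (x' * y = y * x' * expgz z c')%g ->
  (x * x' * y = y * (x * x') * expgz z (c + c'))%g.
Proof.
move=> xy x'y; rewrite -mulgA x'y !mulgA xy expgzD !mulgA; congr (_ * _)%g.
by rewrite -!mulgA; congr (_ * (_ * _))%g; exact: expgz_central.
Qed.

Lemma swap_lprod s e y (w : G -> int) : (forall x, (x * y = y * x * expgz z (w x))%g) ->
  (lprod s e * y = y * lprod s e * expgz z (\sum_(i < size s) e i * w (nth 1%g s i)))%g.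
Proof.
move=> W; elim: s e => [|x s IH] e /=; first by rewrite big_ord0 mul1g !mulg1.
by rewrite big_ord_recl; apply: swap_mul; [exact: swap_expgzl|exact: IH].
Qed.

Lemma swap_lprods s e s' f (w : G -> G -> int) :
  (forall x y, (x * y = y * x * expgz z (w x y))%g) ->
  (lprod s e * lprod s' f = lprod s' f * lprod s e *
    expgz z (\sum_(i < size s) \sum_(j < size s')
               e i * f j * w (nth 1%g s i) (nth 1%g s' j)))%g.
Proof.
move=> W.
have W' x : (x * lprod s' f = lprod s' f * x *
    expgz z (\sum_(j < size s') f j * w x (nth 1%g s' j)))%g.
  have := @swap_lprod s' f x (fun y => - w x y) (fun y => swap_sym (W x y)).
  move=> /swap_sym ->; congr (_ * expgz z _)%g; rewrite -sumrN; apply: eq_bigr => j _.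
  by rewrite mulrN opprK.
rewrite (swap_lprod s e W'); congr (_ * expgz z _)%g; apply: eq_bigr => i _.
by rewrite mulr_sumr; apply: eq_bigr => j _; rewrite mulrA.
Qed.

Section Independent.
Variable zok : bool.
Hypothesis z_free : forall c, zok || (c == 0) -> expgz z c = 1%g -> c = 0.

(** The flag treats both cases at once: for [zok = true] independence includes [z], which then has
    infinite order; for [zok = false] only [c = 0] occurs and spans contain no power of [z]. *)
Definition independent (ys : seq G) : Prop :=
  forall v c, zok || (c == 0) -> (lprod ys v * expgz z c = 1)%g ->
    (forall i, (i < size ys)%N -> v i = 0) /\ c = 0.

Definition in_span (ys : seq G) g : Prop :=
  exists v c, zok || (c == 0) /\ g = (lprod ys v * expgz z c)%g.

Lemma in_span_expgz ys g a : {in ys &, forall x y, commute x y} ->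
  in_span ys g -> in_span ys (expgz g a).
Proof.
move=> C [v [c [cok ->]]]; exists (fun i => v i * a), (c * a); split.
  by case/orP: cok => [->//|/eqP ->]; rewrite mul0r eqxx orbT.
by rewrite lprodZ // expgzMl ?expgzM //; exact/commute_sym/expgz_central.
Qed.

Lemma in_spanN ys g : {in ys &, forall x y, commute x y} ->
  in_span ys g -> in_span ys g^-1%g.
Proof. by move=> C /(in_span_expgz (- 1) C); rewrite expgzN. Qed.

(** Greedy choice: [g] joins the family if no nonzero power of it lies in the span of the elements
    already kept; otherwise the exponent of such a power is multiplied into [N]. Torsion disappears
    in the same way. *)
Lemma exists_independent (gs : seq G) : {in gs &, forall x y, commute x y} ->
  exists ys N, [/\ {subset ys <= gs}, (0 < N)%N, independent ys &
    {in gs, forall g, in_span ys (g ^+ N)%g}].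
Proof.
elim: gs => [|g gs IH] C.
  exists [::], 1%N; split=> // v c cok; rewrite mul1g => /z_free c0.
  by split=> //; apply: c0.
have [|ys [N [sub N0 ind sp]]] := IH.
  by move=> x y xs ys; apply: C; rewrite inE ?xs ?ys orbT.
have Cy : {in ys &, forall x y, commute x y}.
  by move=> x y /sub xs /sub y_s; apply: C; rewrite inE ?xs ?y_s orbT.
have [[a [a0 ga]]|nog] := pselect (exists a, a != 0 /\ in_span ys (expgz g a)).
  exists ys, (absz a * N)%N; split=> //.
  - by move=> y /sub; rewrite inE => ->; rewrite orbT.
  - by rewrite muln_gt0 absz_gt0 a0.
  - move=> h; rewrite inE => /orP[/eqP ->|/sp hs]; last first.
      by rewrite mulnC expgnA -expgz_nat; apply: in_span_expgz.
    have -> : (g ^+ (absz a * N) = expgz (expgz g a) (sgz a * N%:Z))%g.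
      by rewrite -expgzM mulrA -expgz_nat PoszM abszEsg (mulrC a).
    exact: in_span_expgz.
exists (g :: ys), N; split=> //.
- by move=> y; rewrite !inE => /orP[->//|/sub ->]; rewrite orbT.
- move=> v c cok /=; rewrite -mulgA => E.
  have sg : in_span ys (expgz g (v 0%N)).
    have -> : expgz g (v 0%N) = (lprod ys (fun i => v i.+1) * expgz z c)^-1%g.
      by apply: (@mulIg _ (lprod ys (fun i => v i.+1) * expgz z c)%g); rewrite mulVg.
    by apply: in_spanN => //; exists (fun i => v i.+1), c.
  have v0 : v 0%N = 0 by apply: contrapT => /eqP v0; apply: nog; exists (v 0%N).
  rewrite v0 mul1g in E; have [vi c0] := ind _ _ cok E.
  by split=> // -[|i] //= /vi.
- move=> h; rewrite inE => /orP[/eqP ->|/sp [v [c [cok ->]]]].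
    exists (econs N%:Z (fun=> 0)), 0; split; first by rewrite eqxx orbT.
    by rewrite lprod_cons lprod0 // !mulg1.
  by exists (econs 0 v), c; split=> //; rewrite lprod_cons mul1g.
Qed.

End Independent.

(** * Splitting the commutator form when [z] has infinite order *)

Section Symplectic.
Hypothesis z_inf : forall c, expgz z c = 1%g -> c = 0.

Lemma not_commute x y : ~ commute x y -> exists2 d, d != 0 & (x * y = y * x * expgz z d)%g.
Proof.
move=> nc; have [d dE] := comz x y; exists d => //; apply/eqP => d0.
by apply: nc; rewrite /commute dE d0 mulg1.
Qed.

(* A pair with [x, y] <> 1 splits off: every other generator [g] is replaced by
   [g ^ d * x ^ - q * y ^ p], which commutes with [x] and [y]. *)
Lemma exists_symplectic (gs : seq G) : exists (xs ys : seq G) (N : nat),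
  [/\ {in xs &, forall x y, commute x y} /\ {in ys &, forall x y, commute x y},
      (0 < N)%N,
      forall h, {in gs, forall g, commute h g} -> {in xs ++ ys, forall x, commute h x},
      forall u v c, (lprod xs u * lprod ys v * expgz z c = 1)%g ->
        [/\ forall i, (i < size xs)%N -> u i = 0,
            forall j, (j < size ys)%N -> v j = 0 & c = 0] &
      {in gs, forall g, exists u v, eqmod (g ^+ N)%g (lprod xs u * lprod ys v)%g}].
Proof.
have [k] := ubnP (size gs); elim: k gs => // k IH gs szk.
have [C|nC] := pselect {in gs &, forall x y, commute x y}.
  (* No nonzero commutator is left: the remaining abelian part goes entirely into [ys]. *)
  have [|ys [N [sub N0 ind sp]]] := @exists_independent true _ gs C.
    by move=> c _; exact: z_inf.
  exists [::], ys, N; split=> //.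
  - by split=> // x y /sub xs /sub y_s; apply: C.
  - by move=> h hg x /= /sub; apply: hg.
  - by move=> u v c; rewrite mul1g => /(ind _ _ isT)[? ?].
  - move=> g /sp[v [c [_ ->]]]; exists (fun=> 0), v, c; by rewrite mul1g.
have [x [y [xs [y_s nxy]]]] : exists x y, x \in gs /\ y \in gs /\ ~ commute x y.
  apply: contrapT => H; apply: nC => x y xs y_s; apply: contrapT => nxy.
  by apply: H; exists x, y.
have [d d0 xy] := not_commute nxy.
have /choice[p pE] g : exists a, (g * x = x * g * expgz z a)%g by exact: comz.
have /choice[q qE] g : exists a, (g * y = y * g * expgz z a)%g by exact: comz.
pose f g := (expgz g d * expgz x (- q g) * expgz y (p g))%g.
have fx g : commute (f g) x.
  have H := swap_mul (swap_mul (swap_expgzl d (pE g))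
                       (swap_expgzl (- q g) (swap_comm (commute_refl x))))
                     (swap_expgzl (p g) (swap_sym xy)).
  rewrite /commute /f H (_ : _ + _ = 0) ?mulg1 //; ring.
have fy g : commute (f g) y.
  have H := swap_mul (swap_mul (swap_expgzl d (qE g)) (swap_expgzl (- q g) xy))
                     (swap_expgzl (p g) (swap_comm (commute_refl y))).
  rewrite /commute /f H (_ : _ + _ = 0) ?mulg1 //; ring.
pose rest := [seq g <- gs | (g != x) && (g != y)].
have [|xs' [ys' [N [[Cx Cy] N0 sub ind sp]]]] := IH (map f rest).
  rewrite ltnS in szk; rewrite size_map /rest size_filter; apply: leq_trans szk.
  rewrite -(count_predC (fun g => (g != x) && (g != y)) gs) -[X in (X < _)%N]addn0 ltn_add2l.
  by rewrite -has_count; apply/hasP; exists x => //=; rewrite eqxx.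
(* The third clause of the induction hypothesis is designed for this: what commutes with every [f g]
   commutes with everything built from them. *)
have xcom : {in xs' ++ ys', forall g, commute x g}.
  by apply: sub => _ /seq.mapP[g _ ->]; exact/commute_sym.
have ycom : {in xs' ++ ys', forall g, commute y g}.
  by apply: sub => _ /seq.mapP[g _ ->]; exact/commute_sym.
exists (x :: xs'), (y :: ys'), (absz d * N)%N; split.
- split=> a b; rewrite !inE => /orP[/eqP->|ai] /orP[/eqP->|bi] //.
  + by apply: xcom; rewrite mem_cat bi.
  + by apply/commute_sym/xcom; rewrite mem_cat ai.
  + exact: Cx.
  + by apply: ycom; rewrite mem_cat bi orbT.
  + by apply/commute_sym/ycom; rewrite mem_cat ai orbT.
  + exact: Cy.
- by rewrite muln_gt0 absz_gt0 d0.
- move=> h hg.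
  have hsub : {in xs' ++ ys', forall x, commute h x}.
    apply: sub => a /seq.mapP[g]; rewrite mem_filter => /andP[_ gi] ->.
    by apply: commuteM; [apply: commuteM|]; apply: commute_expgz; exact: hg.
  move=> a; rewrite mem_cat !inE -orbA => /or4P[/eqP->|ai|/eqP->|ai]; try exact: hg.
    by apply: hsub; rewrite mem_cat ai.
  by apply: hsub; rewrite mem_cat ai orbT.
- move=> u v c /= E.
  set X' := lprod xs' _ in E; set Y' := lprod ys' _ in E.
  have Xc w : {in xs' ++ ys', forall g, commute w g} -> commute w X' /\ commute w Y'.
    by move=> H; split; apply: commute_lprod => g gi; apply: H; rewrite mem_cat gi ?orbT.
  have [xX xY] := Xc _ xcom; have [yX yY] := Xc _ ycom.
  (* Moving the relation [E] past [y] detects only the exponent of [x], with value [u 0 * d]; moving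
     it past [x] detects only that of [y]. Both vanish since [d] is nonzero and [z] has infinite
     order. *)
  have Hy := swap_mul (swap_mul (swap_mul (swap_expgzl (u 0%N) xy) (swap_comm (commute_sym yX)))
     (swap_mul (swap_expgzl (v 0%N) (swap_comm (commute_refl y))) (swap_comm (commute_sym yY))))
     (swap_comm (expgz_central c y)).
  have Hx := swap_mul (swap_mul
     (swap_mul (swap_expgzl (u 0%N) (swap_comm (commute_refl x))) (swap_comm (commute_sym xX)))
     (swap_mul (swap_expgzl (v 0%N) (swap_sym xy)) (swap_comm (commute_sym xY))))
     (swap_comm (expgz_central c x)).
  have u0 : u 0%N = 0.
    move: Hy; rewrite E mul1g mulg1 -{1}[y]mulg1 => /mulgI/esym/z_inf.
    rewrite !mulr0 !addr0 => /eqP; rewrite mulf_eq0 (negbTE d0) orbF => /eqP //.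
  have v0 : v 0%N = 0.
    move: Hx; rewrite E mul1g mulg1 -{1}[x]mulg1 => /mulgI/esym/z_inf.
    rewrite !mulr0 !addr0 !add0r => /eqP; rewrite mulf_eq0 oppr_eq0 (negbTE d0) orbF => /eqP //.
  rewrite u0 v0 !expgz0 !mul1g in E; have [ui vi c0] := ind _ _ _ E.
  by split=> // -[|i] //=; [move=> /ui|move=> /vi].
- move=> g gi.
  have gen (b : G) : b \in gs -> (b == x) || (b == y) ->
      exists u v, eqmod (b ^+ (absz d * N))%g (lprod (x :: xs') u * lprod (y :: ys') v)%g.
    move=> bi /orP[/eqP->|/eqP->].
      exists (econs (absz d * N)%N%:Z (fun=> 0)), (econs 0 (fun=> 0)).
      by rewrite !lprod_cons !lprod0 // !mulg1; exact: eqmod_refl.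
    exists (econs 0 (fun=> 0)), (econs (absz d * N)%N%:Z (fun=> 0)).
    by rewrite !lprod_cons !lprod0 // !mulg1 mul1g; exact: eqmod_refl.
  case: (boolP ((g == x) || (g == y))) => [/gen|]; first exact.
  rewrite negb_or => gxy.
  have [|u [v uv]] := sp (f g).
    by apply/map_f; rewrite mem_filter gxy.
  (* [f g] involves [g] to the possibly negative power [d], while the claim is about the exponent
     [absz d], which is [d * sgz d]. *)
  pose a := sgz d.
  pose u' := econs (q g * N%:Z * a) (fun i => u i * a).
  pose v' := econs (- p g * N%:Z * a) (fun i => v i * a).
  exists u', v'; rewrite /u' /v' !lprod_cons.
  have -> : (g ^+ (absz d * N) = expgz (expgz (expgz g d) N%:Z) a)%g.
    rewrite -!expgzM -expgz_nat PoszM; congr expgz.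
    by rewrite abszEsg -/a; ring.
  have gE : expgz g d = (f g * (expgz y (- p g) * expgz x (q g)))%g.
    rewrite /f !mulgA -[X in (X * expgz x (q g))%g]mulgA -expgzD subrr mulg1.
    by rewrite -mulgA -expgzD addNr mulg1.
  rewrite {}gE.
  have step1 : eqmod (expgz (f g * (expgz y (- p g) * expgz x (q g))) N%:Z)
      (lprod xs' u * lprod ys' v * (expgz y (- p g * N%:Z) * expgz x (q g * N%:Z)))%g.
    apply: eqmod_trans (eqmod_expgzMl _ _ _) _; apply: eqmodM; first exact: uv.
    by apply: eqmod_trans (eqmod_expgzMl _ _ _) _; rewrite !expgzM; exact: eqmod_refl.
  apply: eqmod_trans (eqmod_expgz a step1) _.
  apply: eqmod_trans (eqmod_expgzMl _ _ _) _.
  apply: eqmod_trans (eqmodM (eqmod_expgzMl _ _ _) (eqmod_expgzMl _ _ _)) _.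
  rewrite -!expgzM; apply: eqmod_trans (eqmodC _ _) _.
  have Z s e := eqmod_sym (eqmod_lprodZ s e a).
  apply: eqmod_trans (eqmodM (eqmodC _ _) (eqmodM (Z _ _) (Z _ _))) _.
  exact: eqmod_perm.
Qed.

End Symplectic.

(** Modulo [z], each exponent is divided by [N]: the quotients give an element of [S], and the
    remainders range over a finite set. *)
Lemma exists_transversal (gs : seq G) (N : nat) (S : G -> Prop) :
  (0 < N)%N -> S 1%g -> (forall g h, S g -> S h -> S (g * h)%g) ->
  {in gs, forall g a, S (expgz (g ^+ N)%g a)} ->
  exists T : seq G, forall e, exists h t, [/\ S h, t \in T & eqmod (lprod gs e) (h * t)%g].
Proof.
move=> N0 S1 SM; elim: gs => [|g gs IH] Sg.
  by exists [:: 1%g] => e; exists 1%g, 1%g; split; rewrite ?inE // mulg1; exact: eqmod_refl.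
have [|T HT] := IH; first by move=> h hs; apply: Sg; rewrite inE hs orbT.
exists [seq (g ^+ r * t)%g | r <- iota 0 N, t <- T] => e.
have [h [t [Sh tT ht]]] := HT (fun i => e i.+1).
pose r := absz (e 0%N %% N%:Z)%Z.
have N0' : N%:Z != 0 by rewrite eqz_nat -lt0n.
have rN : (r < N)%N.
  by have := ltz_pmod (e 0%N) (_ : 0 < N%:Z); have := modz_ge0 (e 0%N) N0'; lia.
exists (expgz (g ^+ N)%g (e 0%N %/ N%:Z)%Z * h)%g, (g ^+ r * t)%g; split.
- by apply: SM => //; apply: Sg; rewrite inE eqxx.
- by apply/allpairsP; exists (r, t); split; rewrite ?mem_iota.
have -> : lprod (g :: gs) e =
   (expgz (g ^+ N)%g (e 0%N %/ N%:Z)%Z * g ^+ r * lprod gs (fun i => e i.+1))%g.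
  rewrite /= -!expgz_nat -expgzM -expgzD; congr (expgz _ _ * _)%g.
  rewrite {1}(divz_eq (e 0%N) N%:Z) mulrC; congr (_ + _).
  by rewrite /r gez0_abs // modz_ge0.
apply: eqmod_trans (eqmodM (eqmod_refl _) ht) _; exact: eqmod_perm.
Qed.

End CyclicCommutators.

Section Existence.
Variables (G : groupType) (z : G).
Hypothesis z_central : forall g, commute z g.
Hypothesis comz : forall x y : G, exists a, (x * y = y * x * expgz z a)%g.

Definition extend (n : nat) (u : {ffun 'I_n -> int}) (i : nat) : int :=
  oapp u 0 (insub i).

Lemma extendE n (u : {ffun 'I_n -> int}) (i : 'I_n) : extend u i = u i.
Proof. by rewrite /extend valK. Qed.

Lemma lprod_extendD (s : seq G) (u u' : {ffun 'I_(size s) -> int}) :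
  {in s &, forall x y, commute x y} ->
  lprod s (extend (u + u')) = (lprod s (extend u) * lprod s (extend u'))%g.
Proof.
move=> C; rewrite -lprodD //; apply: eq_lprod => i si.
by rewrite -[i]/(val (Ordinal si)) !extendE ffunE.
Qed.

Lemma lprod_trunc (s : seq G) (e : nat -> int) :
  lprod s (extend [ffun i : 'I_(size s) => e i]) = lprod s e.
Proof. by apply: eq_lprod => i si; rewrite -[i]/(val (Ordinal si)) extendE ffunE. Qed.

Lemma make_polarization (xs ys T : seq G) (zok : bool) :
  {in xs &, forall x y, commute x y} -> {in ys &, forall x y, commute x y} ->
  (~~ zok -> xs = [::]) ->
  (forall u v c, zok || (c == 0) -> (lprod xs u * lprod ys v * expgz z c = 1)%g ->
     [/\ forall i, (i < size xs)%N -> u i = 0,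
         forall j, (j < size ys)%N -> v j = 0 & c = 0]) ->
  (forall g, exists u v c t, [/\ zok || (c == 0), t \in T &
     g = (lprod xs u * lprod ys v * expgz z c * t)%g]) ->
  exists P : polarization G, True.
Proof.
move=> Cx Cy xs0 ind gen.
have /choice[W' WE'] xy : exists a, (xy.1 * xy.2 = xy.2 * xy.1 * expgz z a)%g by exact: comz.
pose W x y := W' (x, y).
have WE x y : (x * y = y * x * expgz z (W x y))%g := WE' (x, y).
unshelve eexists (@Polarization G (size xs) (size ys)
  (fun u => lprod xs (extend u)) (fun v => lprod ys (extend v)) (expgz z)
  (fun i j => W (nth 1%g xs i) (nth 1%g ys j)) zok T _ _ _ _ _ _ _ _) => //.
- by move=> u u'; apply: lprod_extendD.
- by move=> u u'; apply: lprod_extendD.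
- exact: expgzD.
- exact: (expgz_central z_central).
- move=> u v; rewrite (swap_lprods z_central _ _ _ _ WE); congr (_ * expgz z _)%g.
  by apply: eq_bigr => i _; apply: eq_bigr => j _; rewrite !extendE.
- by move=> /xs0 xsE [i ilt] j; exfalso; rewrite xsE in ilt.
- move=> u v c cok /(ind _ _ _ cok)[u0 v0 c0]; split=> //; apply/ffunP => i; rewrite ffunE.
    by rewrite -extendE u0.
  by rewrite -extendE v0.
- move=> g; have [u [v [c [t [cok tT ->]]]]] := gen g.
  exists [ffun i : 'I_(size xs) => u i], [ffun i : 'I_(size ys) => v i], c, t.
  by rewrite !lprod_trunc.
Qed.

Lemma exists_polarization (gs : seq G) :
  (forall g, exists e, eqmod z g (lprod gs e)) -> exists P : polarization G, True.
Proof.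
move=> gen.
have [z_inf|fin] := pselect (forall c, expgz z c = 1%g -> c = 0).
  have [xs [ys [N [[Cx Cy] N0 _ ind sp]]]] := exists_symplectic z_central comz z_inf gs.
  pose S g := exists u v, eqmod z g (lprod xs u * lprod ys v)%g.
  have [|||T HT] := exists_transversal z_central comz (gs := gs) (S := S) N0.
  - exists (fun=> 0), (fun=> 0); rewrite !lprod0 // mulg1; exact: eqmod_refl.
  - move=> g h [u [v guv]] [u' [v' huv]].
    exists (fun i => u i + u' i), (fun i => v i + v' i); rewrite !lprodD //.
    apply: eqmod_trans (eqmodM z_central guv huv) _; exact: eqmod_perm.
  - move=> g gi a; have [u [v guv]] := sp g gi.
    exists (fun i => u i * a), (fun i => v i * a); rewrite !lprodZ //.
    apply: eqmod_trans (eqmod_expgz z_central a guv) _; exact: eqmod_expgzMl.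
  apply: (@make_polarization xs ys T true) => // [u v c _|g]; first exact: ind.
  have [e ge] := gen g; have [h [t [[u [v huv]] tT ht]]] := HT e.
  have [c gE] : eqmod z g (lprod xs u * lprod ys v * t)%g.
    apply: eqmod_trans ge _; apply: eqmod_trans ht _; apply: (eqmodM z_central huv); exact: eqmod_refl.
  exists u, v, c, t; split=> //; rewrite gE -mulgA -[RHS]mulgA; congr (_ * _)%g.
  exact/commute_sym/expgz_central.
have [k k0 zk] : exists2 k : nat, (0 < k)%N & (z ^+ k = 1)%g.
  apply: contrapT => nk; apply: fin => c; case: (c) => k zk.
    apply: contrapT => /eqP k0; apply: nk; exists k => //; by rewrite lt0n.
  by exfalso; apply: nk; exists k.+1 => //; move: zk => /= zk; rewrite -[LHS]invgK zk invg1.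
have zka (a : int) : expgz z (k%:Z * a) = 1%g.
  by rewrite expgzM expgz_nat zk; case: a => j /=; rewrite expg1n ?invg1.
(* The commutator of [g ^+ k] with [h] is the k-th power of that of [g] with [h], a power of
   [z ^+ k = 1]. *)
have cent (g h : G) : commute (g ^+ k)%g h.
  have [a gh] := comz g h.
  by rewrite /commute -expgz_nat (swap_expgzl z_central k%:Z gh) zka mulg1.
have [||ys [N [sub N0 ind sp]]] := @exists_independent G z z_central false _ [seq (g ^+ k)%g | g <- gs].
- by move=> c /eqP.
- by move=> x y /seq.mapP[g _ ->] _; exact: cent.
have Cy : {in ys &, forall x y, commute x y}.
  by move=> x y /sub/seq.mapP[g _ ->] _; exact: cent.
pose S g := exists v, g = lprod ys v.
(* The independent family was chosen among k-th powers, so a generator enters its span only at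
   exponent [k * N]. *)
have [||| |T HT] := exists_transversal z_central comz (gs := gs) (S := S) (N := (k * N)%N).
- by rewrite muln_gt0 k0.
- by exists (fun=> 0); rewrite lprod0.
- by move=> g h [v ->] [v' ->]; exists (fun i => v i + v' i); rewrite lprodD.
- move=> g gi a; have [|v [c [/eqP -> gv]]] := sp (g ^+ k)%g; first exact: map_f.
  by exists (fun i => v i * a); rewrite expgnA gv mulg1 lprodZ.
(* The finitely many powers of [z] are moved into the representatives, which is why the third
   coordinate can be absent. *)
pose T' := [seq (t * expgz z (r : nat)%:Z)%g | t <- T, r <- iota 0 k].
apply: (@make_polarization [::] ys T' false) => //.
  by move=> u v c cok /=; rewrite mul1g => /(ind _ _ cok)[? ?].
move=> g; have [e ge] := gen g; have [h [t [[v hv] tT ht]]] := HT e.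
have [c gE] : eqmod z g (lprod ys v * t)%g by rewrite -hv; apply: eqmod_trans ge ht.
have k0' : k%:Z != 0 by rewrite eqz_nat -lt0n.
pose r := absz (c %% k%:Z)%Z.
have rk : (r < k)%N by have := ltz_pmod c (_ : 0 < k%:Z); have := modz_ge0 c k0'; lia.
have zr : expgz z c = expgz z r%:Z.
  rewrite {1}(divz_eq c k%:Z) expgzD mulrC zka mul1g; congr expgz.
  by rewrite /r gez0_abs // modz_ge0.
exists (fun=> 0), v, 0, (t * expgz z r%:Z)%g; split=> //.
  by apply/allpairsP; exists (t, r); split; rewrite ?mem_iota.
by rewrite gE zr mul1g mulg1 mulgA.
Qed.

End Existence.

Section Generated.
Variable G : groupType.
Implicit Types (A H : set G).

Lemma sub_generated A g : A g -> generated A g.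
Proof. by move=> Ag H [_ AH]; exact: AH. Qed.

Lemma generated_ind A H : H 1%g -> (forall x y, H x -> H y -> H (x / y)%g) ->
  (forall g, A g -> H g) -> forall g, generated A g -> H g.
Proof.
move=> H1 HD AH g; apply; split=> //; split; first exact: mem_set.
by move=> x y /set_mem Hx /set_mem Hy; apply: mem_set; exact: HD.
Qed.

End Generated.

Theorem theorem6p2 (R : realType) (G : groupType)
    (fgG : finitely_generated G)
    (nilG : nilpotent_of_class G 2)
    (cycG' : cyclic_subgroup (@commutator_subgroup G setT setT)) :
  exists (X : {fset G}) (L : set (word X)),
    [/\ inverse_closed X, generates X, real_time_combing R L,
        bounded_async_combing R L & at_most_quadratic_length R L].
Proof.
have [X0 X0E] := fgG; have [L2 Lne] := nilG; have [z zE] := cycG'.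
(* Class exactly 2 excludes the trivial group; [g0] is the nontrivial element from which the
   injective code is built. *)
have [g0 g01] : exists g0 : G, g0 != 1%g.
  apply: contrapT => triv; apply: (Lne 0%N) => //.
  apply/seteqP; split=> // g _ /=; apply: contrapT => /eqP g1.
  by apply: triv; exists g.
(* [z] lies in the commutator subgroup, so its commutators lie in the next term of the lower central
   series, which is trivial. *)
have z_central g : commute z g.
  apply/commgP/eqP.
  have : @lower_central G 2 [~ z, g]%g.
    apply: sub_generated; exists z; last by exists g.
    by rewrite /= zE; apply: sub_generated.
  by rewrite L2.
have comz x y : exists a, (x * y = y * x * expgz z a)%g.
  have : commutator_subgroup setT setT [~ x, y]%g.
    by apply: sub_generated; exists x => //; exists y.
  rewrite zE => /(generated_ind (H := [set g | exists a, g = expgz z a]%classic)) [].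
  - by exists 0.
  - by move=> _ _ [a ->] [b ->]; exists (a - b); rewrite expgzD expgzN.
  - by move=> _ ->; exists 1.
  - by move=> a aE; exists a; rewrite -aE -commgC.
have gen g : exists e, eqmod z g (lprod (enum_fset X0) e).
  have : generated [set` X0]%classic g by rewrite X0E.
  apply: (generated_ind (H := [set g | exists e, eqmod z g (lprod (enum_fset X0) e)]%classic)).
  - by exists (fun=> 0); rewrite lprod0 //; exact: eqmod_refl.
  - move=> x y [e xe] [f yf]; exists (fun i => e i + - f i).
    apply: eqmod_trans (eqmodM z_central xe (eqmodV z_central yf)) _.
    apply: eqmod_sym; apply: eqmod_trans (eqmod_lprodD z_central comz _ _ _) _.
    apply: (eqmodM z_central (eqmod_refl _ _)); exact: eqmod_lprodN.
  move=> x /= xX; exists (fun i => (i == index x (enum_fset X0))%:Z).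
  suff -> : lprod (enum_fset X0) (fun i => (i == index x (enum_fset X0))%:Z) = x by exact: eqmod_refl.
  have {xX} : x \in enum_fset X0 by [].
  elim: (enum_fset X0) => // y s IH; rewrite inE /= eq_sym; case: eqP => [-> _|_ /= xs].
    by rewrite lprod0 ?mulg1.
  by rewrite mul1g -[RHS]IH //; apply: eq_lprod.
have [P _] := exists_polarization z_central comz gen.
exact: polarization_combing P _ g01.
Qed.
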